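(* Let $X$ be a complex Banach space and let $T$ be a closed linear relation in $X$. Suppose $\mu\in\rho(T)$, and put $T_\mu:=(\mu-T)^{-1}$. Then for $i=1,2,3,4,5$ and every $\lambda\in\mathbb{C}$ with $\lambda\neq\mu$, $$\lambda\in\sigma_{ei}(T)\iff(\mu-\lambda)^{-1}\in\sigma_{ei}(T_\mu).$$
   Context: A linear relation $T$ in $X$ (written $T\in LR(X)$) is a set-valued map whose graph $G(T)=\{(x,y): y\in Tx\}$ is a linear subspace of $X\times X$. Its domain is $D(T)=\{x: Tx\neq\emptyset\}$, its range is $R(T)=\bigcup_{x\in D(T)}Tx$, its null space is $N(T)=\{x\in D(T): 0\in Tx\}$. $T$ is closed if $G(T)$ is closed. The inverse $T^{-1}$ is the relation with graph $\{(y,x):(x,y)\in G(T)\}$; $\lambda-T$ means $\lambda I-T$, i.e. $(\lambda-T)x=\lambda x-Tx$ for $x\in D(T)$. Let $\alpha(T)=\dim N(T)$, $\beta(T)=\dim X/R(T)$, and $\kappa(T)=\alpha(T)-\beta(T)$ when at least one of these is finite (with value $\infty$ if only $\alpha(T)=\infty$, and $-\infty$ if only $\beta(T)=\infty$). A closed linear relation $T$ belongs to $\Phi_+$ if $R(T)$ is closed and $\alpha(T)<\infty$; to $\Phi_-$ if $R(T)$ is closed and $\beta(T)<\infty$; and $\Phi=\Phi_+\cap\Phi_-$. The resolvent set $\rho(T)$ of a closed relation in $X$ is the set of $\lambda\in\mathbb{C}$ such that $N(\lambda-T)=\{0\}$ and $R(\lambda-T)=X$ (equivalently $(\lambda-T)^{-1}$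 is an everywhere defined bounded single-valued operator); $\sigma(T)=\mathbb{C}\setminus\rho(T)$. Essential resolvent sets: $\rho_{e1}(T)=\{\lambda\in\mathbb{C}:\lambda-T\in\Phi_+\cup\Phi_-\}$; $\rho_{e2}(T)=\{\lambda:\lambda-T\in\Phi_+\}$; $\rho_{e3}(T)=\{\lambda:\lambda-T\in\Phi\}$; $\rho_{e4}(T)=\{\lambda:\lambda-T\in\Phi,\ \kappa(\lambda-T)=0\}$; $\rho_{e5}(T)$ is the union of those connected components of $\rho_{e1}(T)$ that intersect $\rho(T)$. The essential spectra are $\sigma_{ei}(T)=\mathbb{C}\setminus\rho_{ei}(T)$, $i=1,\dots,5$. *)

(* Defs.v *)
From mathcomp Require Import all_boot all_order all_algebra complex.
From mathcomp Require Import all_classical all_reals all_analysis.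

Set Implicit Arguments.
Unset Strict Implicit.
Unset Printing Implicit Defensive.

Import Order.TTheory GRing.Theory Num.Theory numFieldNormedType.Exports.

Local Open Scope classical_set_scope.
Local Open Scope ring_scope.

(* The complex numbers [R[i]], typed as a [numClosedFieldType]: the topology
   induced by the modulus is attached to the sort of that structure and is not
   found on the bare type [R[i]]. *)
Definition Cplx (R : realType) : numClosedFieldType := complex R.

Section Dimension.
Context {K : fieldType} {V : lmodType K}.
Implicit Types (U W : set V) (n : nat).

(* The cosets [v i + W] form a basis of the quotient space [U / W], for linear
   subspaces [W `<=` U]. *)
Definition quotient_basis U W n (v : 'I_n -> V) : Prop :=
  [/\ forall i, U (v i),
      forall c : 'I_n -> K, W (\sum_i c i *: v i) -> forall i, c i = 0 &
      forall x, U x -> exists c : 'I_n -> K, W (x - \sum_i c i *: v i)].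

Definition has_quotient_basis U W n : Prop :=
  exists v : 'I_n -> V, quotient_basis U W v.

(* dim (U / W), with value +oo when there is no finite basis.  The integer
   selected by [xget] is unique, by [quotient_dimE]. *)
Definition quotient_dim U W : \bar int :=
  if `[< exists n, has_quotient_basis U W n >]
  then (Posz (xget 0%N [set n | has_quotient_basis U W n]))%:E
  else +oo%E.

Lemma has_quotient_basis_leq U W m n : submod_closed [in W] ->
  has_quotient_basis U W m -> has_quotient_basis U W n -> (m <= n)%N.
Proof.
move=> subW [v [Uv freev _]] [w [_ _ genw]].
have W0 : W 0 by have [/set_mem] := subW.
have WD a x y : W x -> W y -> W (a *: x + y).
  by have [_ h] := subW; move=> Wx Wy; apply/set_mem/h; apply/mem_set.
have Wsum (F : 'I_m -> V) (c : 'I_m -> K) :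
    (forall i, W (F i)) -> W (\sum_i c i *: F i).
  by move=> WF; elim/big_rec: _ => // i x _; apply: WD.
have [A HA] := choice (fun i => genw _ (Uv i)).
pose M := \matrix_(i < m, j < n) A i j.
suff : row_free M.
  by rewrite -row_leq_rank => /leq_trans; apply; apply: rank_leq_col.
apply: inj_row_free => u uM.
apply/rowP => i; rewrite mxE; move: i; apply: freev.
suff -> : \sum_i u 0 i *: v i =
    \sum_i u 0 i *: (v i - \sum_j A i j *: w j) by exact: Wsum.
under [RHS]eq_bigr do rewrite scalerBr.
rewrite sumrB -[LHS]subr0; congr (_ - _).
under [RHS]eq_bigr do rewrite scaler_sumr.
rewrite exchange_big /= big1// => j _.
under eq_bigr do rewrite scalerA.
rewrite -scaler_suml; suff -> : \sum_i u 0 i * A i j = 0 by rewrite scale0r.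
have /rowP/(_ j) := uM; rewrite !mxE => uMj; rewrite -[RHS]uMj.
by apply: eq_bigr => i _; rewrite mxE.
Qed.

Lemma quotient_dimE U W n : submod_closed [in W] ->
  has_quotient_basis U W n -> quotient_dim U W = (Posz n)%:E.
Proof.
move=> subW Hn; rewrite /quotient_dim asboolT; last by exists n.
case: xgetP => [m _ Hm|/(_ n)//]; congr (Posz _)%:E; apply/eqP.
rewrite eqn_leq; apply/andP; split.
  exact: has_quotient_basis_leq Hm Hn.
exact: has_quotient_basis_leq Hn Hm.
Qed.

End Dimension.

Section LinearRelations.
Context {R : realType} {X : normedModType (Cplx R)}.

Record linear_relation := LinearRelation {
  graph : set (X * X);
  graph_submod : submod_closed [in graph] }.

Implicit Types (T : linear_relation) (l : Cplx R).

Definition image_at T (x : X) : set X := [set y | graph T (x, y)].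

Definition dom T : set X := [set x | image_at T x !=set0].
Definition ran T : set X := \bigcup_(x in dom T) image_at T x.
Definition null T : set X := [set x | dom T x /\ image_at T x 0].

Definition closed_relation T : Prop := closed (graph T).

Lemma inv_rel_subproof T :
  submod_closed [in [set p : X * X | graph T (p.2, p.1)]].
Proof.
have [T0 TD] := graph_submod T; split; first by rewrite inE /=; exact/set_mem.
move=> a p q; rewrite !inE /= => Tp Tq; apply/set_mem.
exact: (TD a (p.2, p.1) (q.2, q.1) (mem_set Tp) (mem_set Tq)).
Qed.

Definition inv_rel T : linear_relation := LinearRelation (inv_rel_subproof T).

Lemma shift_rel_subproof l T :
  submod_closed [in [set (p.1, l *: p.1 - p.2) | p in graph T]].
Proof.
have [T0 TD] := graph_submod T; split.
  rewrite inE /=; exists 0; first exact/set_mem.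
  by rewrite /= scaler0 subr0.
move=> a p q; rewrite !inE /= => -[p' Tp <-] [q' Tq <-].
exists (a *: p' + q'); first by apply/set_mem/TD; exact/mem_set.
congr (_, _) => /=.
by rewrite scalerDr scalerBr opprD !scalerA [l * a]mulrC addrACA.
Qed.

(* The relation l - T *)
Definition shift_rel l T : linear_relation :=
  LinearRelation (shift_rel_subproof l T).

Definition alpha T : \bar int := quotient_dim (null T) [set 0].
Definition beta T : \bar int := quotient_dim [set: X] (ran T).

(* Meaningful when [alpha T] or [beta T] is finite; extended subtraction then
   gives +oo when only [alpha T] is infinite and -oo when only [beta T] is. *)
Definition kappa T : \bar int := (alpha T - beta T)%E.

Definition Phi_plus T : Prop :=
  [/\ closed_relation T, closed (ran T) & (alpha T < +oo)%E].
Definition Phi_minus T : Prop :=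
  [/\ closed_relation T, closed (ran T) & (beta T < +oo)%E].
Definition Phi T : Prop := Phi_plus T /\ Phi_minus T.

Definition resolvent_set T : set (Cplx R) :=
  [set l | null (shift_rel l T) = [set 0] /\ ran (shift_rel l T) = [set: X]].

Definition rho_e1 T : set (Cplx R) :=
  [set l | Phi_plus (shift_rel l T) \/ Phi_minus (shift_rel l T)].
Definition rho_e2 T : set (Cplx R) := [set l | Phi_plus (shift_rel l T)].
Definition rho_e3 T : set (Cplx R) := [set l | Phi (shift_rel l T)].
Definition rho_e4 T : set (Cplx R) :=
  [set l | Phi (shift_rel l T) /\ kappa (shift_rel l T) = 0%E].
Definition rho_e5 T : set (Cplx R) :=
  \bigcup_(D in [set D | (exists2 z, rho_e1 T z &
                            D = connected_component (rho_e1 T) z) /\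
                         D `&` resolvent_set T !=set0]) D.

Definition sigma_e1 T : set (Cplx R) := ~` rho_e1 T.
Definition sigma_e2 T : set (Cplx R) := ~` rho_e2 T.
Definition sigma_e3 T : set (Cplx R) := ~` rho_e3 T.
Definition sigma_e4 T : set (Cplx R) := ~` rho_e4 T.
Definition sigma_e5 T : set (Cplx R) := ~` rho_e5 T.

End LinearRelations.

Arguments linear_relation {R} X.

(* Main.v *)
Require Import Defs.
From mathcomp Require Import all_boot all_order all_algebra complex.
From mathcomp Require Import all_classical all_reals all_analysis.
From mathcomp Require Import ring lra.
Import Order.TTheory GRing.Theory Num.Theory numFieldNormedType.Exports.
Local Open Scope classical_set_scope.
Local Open Scope ring_scope.
Set Implicit Arguments.
Unset Strict Implicit.
Unset Printing Implicit Defensive.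

(* The graphs of [l - T] and [(mu - l)^-1 - Tmu] are [{(x, l x - t)}] and
   [{(mu x - t, (mu - l)^-1 (l x - t))}] for [(x, t)] in the graph of [T]; hence
   these two relations have the same range and the same null space, which
   settles [sigma_e1], ..., [sigma_e4].  For [sigma_e5], the map
   [l |-> (mu - l)^-1] is a homeomorphism away from [mu] and [0], so it suffices
   that deleting one point from a component of [rho_e1] neither disconnects it
   nor makes it miss the resolvent set; this holds because both sets are open.

   Openness is the stability of semi-Fredholm closed relations [G] under
   [G |-> G + e].  If [G] is surjective or injective it follows from the open
   mapping theorem.  If the range has finite codimension, add vectors [(0, w)]
   to [G] until it is surjective; if the null space has finite dimension,
   restrict [G] to closed hyperplanes (given by Hahn-Banach) until it is
   injective. *)

(** * Real-valued norms *)

Section RealNorm.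
Context {R : realType} {V : normedModType (Cplx R)}.
Implicit Types (x y : V) (c : Cplx R).

(** Norms over [Cplx R] are elements of [Cplx R], where the order is only partial. Since they are
    real, taking the real part loses nothing and gives access to a total order and to [lra]. *)
Definition cabs c : R := complex.Re (`|c| : complex R).

Definition nrm x : R := complex.Re (`|x| : complex R).

Lemma nrmE x : `|x| = real_complex R (nrm x) :> Cplx R.
Proof. by symmetry; apply: RRe_real; exact: normr_real. Qed.

Lemma cabsE c : `|c| = real_complex R (cabs c) :> Cplx R.
Proof. by symmetry; apply: RRe_real; exact: normr_real. Qed.

Lemma nrm_ge0 x : 0 <= nrm x.
Proof. by rewrite -ler0c -nrmE normr_ge0. Qed.

Lemma cabs_ge0 c : 0 <= cabs c.
Proof. by rewrite -ler0c -cabsE normr_ge0. Qed.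

Lemma nrmD x y : nrm (x + y) <= nrm x + nrm y.
Proof. by rewrite -lecR rmorphD /= -!nrmE; exact: ler_normD. Qed.

Lemma nrmZ c x : nrm (c *: x) = cabs c * nrm x.
Proof.
by apply: (@complexI R); rewrite rmorphM /= -nrmE -cabsE -nrmE; exact: normrZ.
Qed.

Lemma nrmN x : nrm (- x) = nrm x.
Proof. by rewrite /nrm normrN. Qed.

Lemma nrm0 : nrm 0 = 0.
Proof. by rewrite /nrm normr0. Qed.

Lemma nrm0_eq0 x : nrm x = 0 -> x = 0.
Proof. by move=> x0; apply/eqP; rewrite -normr_eq0 nrmE x0. Qed.

Lemma nrm_gt0 x : x != 0 -> 0 < nrm x.
Proof.
move=> x0; rewrite lt_neqAle nrm_ge0 andbT; apply: contra_neq x0.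
by move/esym/nrm0_eq0.
Qed.

Lemma nrmB x y : nrm (x - y) = nrm (y - x).
Proof. by rewrite -nrmN opprB. Qed.

Lemma nrmDB z x y : nrm (x - y) <= nrm (x - z) + nrm (z - y).
Proof. by rewrite (le_trans _ (nrmD _ _))// addrA subrK. Qed.

Lemma real_pos_Cplx (e : Cplx R) : 0 < e ->
  exists2 r : R, 0 < r & e = real_complex R r.
Proof.
move=> e0; exists (cabs e); last by rewrite -cabsE gtr0_norm.
by rewrite -ltcR -cabsE gtr0_norm.
Qed.

Lemma nbhs_nrmP x (P : set V) :
  nbhs x P <-> exists2 r : R, 0 < r & forall y, nrm (y - x) < r -> P y.
Proof.
split=> [/nbhs_normP[e /real_pos_Cplx[r r0 ->] eP]|[r r0 rP]].
  by exists r => // y yx; apply: eP; rewrite /= distrC nrmE ltcR.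
apply/nbhs_normP; exists (real_complex R r); first by rewrite /= ltcR.
by move=> y /=; rewrite distrC nrmE ltcR; exact: rP.
Qed.

Lemma openP (P : set V) : open P <->
  forall x, P x -> exists2 r : R, 0 < r & forall y, nrm (y - x) < r -> P y.
Proof. by rewrite openE; split=> + x Px => /(_ _ Px)/nbhs_nrmP. Qed.

Lemma closedP (P : set V) : closed P <->
  forall x, (forall e : R, 0 < e -> exists2 y, P y & nrm (x - y) < e) -> P x.
Proof.
split=> [cP x xP|h x cx].
  apply: cP => B /nbhs_nrmP[r r0 rB].
  have [y Py xy] := xP _ r0; exists y; split=> //; apply: rB.
  by rewrite nrmB.
apply: h => e e0.
have /cx[y [Py ye]] : nbhs x [set y | nrm (x - y) < e].
  by apply/nbhs_nrmP; exists e => // y; rewrite nrmB.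
by exists y.
Qed.

End RealNorm.

Section ScalarNorm.
Context {R : realType}.
Implicit Types (c d : Cplx R) (a b : R).

Definition rc a : Cplx R := real_complex R a.

Lemma rcD a b : rc (a + b) = rc a + rc b.
Proof. exact: (rmorphD (real_complex R)). Qed.

Lemma rcN a : rc (- a) = - rc a.
Proof. exact: (rmorphN (real_complex R)). Qed.

Lemma rcM a b : rc (a * b) = rc a * rc b.
Proof. exact: (rmorphM (real_complex R)). Qed.

Lemma rc1 : rc 1 = 1.
Proof. by []. Qed.

Lemma rc0 : rc 0 = 0.
Proof. by []. Qed.

Lemma nrm_cabs c : nrm (c : (Cplx R)^o) = cabs c.
Proof. by []. Qed.

Lemma cabsD c d : cabs (c + d) <= cabs c + cabs d.
Proof. exact: (@nrmD R (Cplx R)^o c d). Qed.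

Lemma cabs0 : cabs (0 : Cplx R) = 0.
Proof. exact: (@nrm0 R (Cplx R)^o). Qed.

Lemma cabsM c d : cabs (c * d) = cabs c * cabs d.
Proof. exact: (@nrmZ R (Cplx R)^o c d). Qed.

Lemma cabsV c : cabs c^-1 = (cabs c)^-1.
Proof.
by apply: (@complexI R); rewrite fmorphV /= -!cabsE normfV.
Qed.

Lemma cabs_real a : cabs (rc a) = `|a|.
Proof. by rewrite /cabs normc_def /= expr0n addr0 sqrtr_sqr. Qed.

Lemma cabs_i : cabs ('i%C : Cplx R) = 1.
Proof. by rewrite /cabs normc_def /= expr0n add0r expr1n sqrtr1. Qed.

Lemma cabs_Re c : `|complex.Re (c : complex R)| <= cabs c.
Proof. by rewrite -lecR -cabsE; exact: normc_ge_Re. Qed.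

Lemma cabs_Im c : `|complex.Im (c : complex R)| <= cabs c.
Proof.
rewrite -lecR -cabsE (normc_def c) lecR -sqrtr_sqr ler_wsqrtr// lerDr.
exact: sqr_ge0.
Qed.

Lemma cabs_ReIm c :
  cabs c <= `|complex.Re (c : complex R)| + `|complex.Im (c : complex R)|.
Proof.
have -> : c = rc (complex.Re (c : complex R)) +
    'i%C * rc (complex.Im (c : complex R)).
  exact: complexE.
apply: le_trans (cabsD _ _) _; rewrite cabsM !cabs_real cabs_i.
by case: c => a b /=; rewrite mul1r !(mul0r, mulr0, mul1r, subr0, addr0, add0r).
Qed.

End ScalarNorm.

(** * Geometrically convergent sequences, with explicit rates *)

(** The general field [K] covers both [R] and [Cplx R]; the first hypothesis supplies the
    Archimedean property that an arbitrary [numFieldType] need not have. *)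
Lemma geometric_cvg (K : numFieldType) (V : completeNormedModType K)
    (u : nat -> V) (M : K) :
  (forall e : K, 0 < e -> exists n, 2 * M / 2 ^+ n < e) ->
  (forall n, `|u n.+1 - u n| <= M / 2 ^+ n) ->
  exists x, forall n, `|x - u n| <= 2 * M / 2 ^+ n.
Proof.
move=> small uM.
have M0 : 0 <= M by have := uM 0; rewrite expr0 divr1; apply: le_trans.
have dist n k : `|u (n + k)%N - u n| <= 2 * M / 2 ^+ n.
  (* The factor [1 - 1 / 2 ^+ k] is the exact partial geometric sum; without it the induction on [k]
     would not close. *)
  suff : `|u (n + k)%N - u n| <= 2 * M / 2 ^+ n * (1 - 1 / 2 ^+ k).
    move=> /le_trans; apply; apply: ler_piMr.
      by rewrite divr_ge0 ?mulr_ge0// exprn_ge0.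
    by rewrite gerBl divr_ge0// exprn_ge0.
  elim: k => [|k IH].
    by rewrite addn0 subrr normr0 expr0 divr1 subrr mulr0.
  rewrite addnS -(subrKA (u (n + k)%N)) (le_trans (ler_normD _ _))//.
  rewrite (le_trans (lerD (uM _) IH))//.
  have n0 : 2 ^+ n != 0 :> K by rewrite expf_neq0// pnatr_eq0.
  have k0 : 2 ^+ k != 0 :> K by rewrite expf_neq0// pnatr_eq0.
  rewrite exprD exprS.
  suff -> : M / (2 ^+ n * 2 ^+ k) + 2 * M / 2 ^+ n * (1 - 1 / 2 ^+ k) =
    2 * M / 2 ^+ n * (1 - 1 / (2 * 2 ^+ k)) by [].
  by field; rewrite k0 n0.
have /cvg_ex[l ul] : cvg (u @ \oo).
  apply: cauchy_cvg; apply: cauchy_exP => e /small[n ne].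
  exists (u n); exists n => // m /= nm; rewrite -ball_normE /= distrC.
  by rewrite -(subnKC nm) (le_lt_trans (dist _ _)).
exists l => n; apply/ler_addgt0Pr => e e0.
move/cvgrPdist_lt : ul => /(_ _ e0)[m _ mP].
rewrite -(subrKA (u (n + m)%N)) addrC (le_trans (ler_normD _ _))// lerD//.
by apply/ltW/mP => /=; rewrite leq_addl.
Qed.

Lemma small_geometric (R : realType) (M e : R) : 0 < e ->
  exists n, M / 2 ^+ n < e.
Proof.
move=> e0; have [M0|M0] := leP M 0.
  by exists 0%N; rewrite expr0 divr1 (le_lt_trans M0).
exists (Num.truncn (M / e)).+1.
rewrite ltr_pdivrMr ?exprn_gt0// -ltr_pdivrMl// mulrC.
apply: lt_trans (truncnS_gt _) _.
by rewrite -natrX ltr_nat ltn_expl.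
Qed.

Section GeometricSequences.
Context {R : realType}.

Lemma geometric_cvgR (u : nat -> R) (M : R) :
  (forall n, `|u n.+1 - u n| <= M / 2 ^+ n) ->
  exists x, forall n, `|x - u n| <= 2 * M / 2 ^+ n.
Proof. by apply: (@geometric_cvg R R) => e; exact: small_geometric. Qed.

Lemma geometric_cvg_nrm (X : completeNormedModType (Cplx R)) (u : nat -> X)
    (M : R) :
  (forall n, nrm (u n.+1 - u n) <= M / 2 ^+ n) ->
  exists x, forall n, nrm (x - u n) <= 2 * M / 2 ^+ n.
Proof.
pose h : {rmorphism R -> complex R} := real_complex R.
have hE (a : R) n : h (a / 2 ^+ n) = h a / 2 ^+ n.
  by rewrite fmorph_div rmorphXn rmorph_nat.
have hM n : h (2 * M / 2 ^+ n) = 2 * h M / 2 ^+ n.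
  by rewrite hE rmorphM rmorph_nat.
move=> uM; have [||x xP] := @geometric_cvg (Cplx R) X u (h M).
- move=> e /real_pos_Cplx[r r0 ->]; have [n nP] := small_geometric (2 * M) r0.
  by exists n; rewrite -hM ltcR.
- by move=> n; rewrite nrmE -[leRHS]hE lecR.
exists x => n; rewrite -lecR -nrmE (le_trans (xP n))//.
by rewrite -hM.
Qed.

(** The real and imaginary parts converge separately, each with error [2 * M / 2 ^+ n]; their sum
    gives the constant 4. *)
Lemma geometric_cvgC (u : nat -> Cplx R) (M : R) :
  (forall n, cabs (u n.+1 - u n) <= M / 2 ^+ n) ->
  exists x, forall n, cabs (x - u n) <= 4 * M / 2 ^+ n.
Proof.
move=> uM.
have [|a aP] := @geometric_cvgR (fun n => complex.Re (u n : complex R)) M.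
  by move=> n; rewrite -raddfB (le_trans (cabs_Re _)).
have [|b bP] := @geometric_cvgR (fun n => complex.Im (u n : complex R)) M.
  by move=> n; rewrite -raddfB (le_trans (cabs_Im _)).
exists (Complex a b : complex R) => n; apply: le_trans (cabs_ReIm _) _.
rewrite !raddfB /= (_ : 4 * M / 2 ^+ n = 2 * M / 2 ^+ n + 2 * M / 2 ^+ n).
  by rewrite lerD.
by rewrite -mulrDl -mulrDl -natrD.
Qed.

End GeometricSequences.

(** * The open mapping theorem for closed linear relations *)

Section LinearSubspace.
Context {K : fieldType} {V : lmodType K}.
Implicit Types (W : set V).

(* [submod_closed], stated for a set rather than for a boolean predicate. *)
Definition linsub W := W 0 /\ forall a x y, W x -> W y -> W (a *: x + y).

Lemma linsubD W x y : linsub W -> W x -> W y -> W (x + y).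
Proof. by move=> [_ WD] Wx Wy; rewrite -[x]scale1r; exact: WD. Qed.

Lemma linsubZ W a x : linsub W -> W x -> W (a *: x).
Proof. by move=> [W0 WD] Wx; rewrite -[_ *: _]addr0; exact: WD. Qed.

Lemma linsubN W x : linsub W -> W x -> W (- x).
Proof. by move=> lW Wx; rewrite -scaleN1r; exact: linsubZ. Qed.

Lemma linsubB W x y : linsub W -> W x -> W y -> W (x - y).
Proof. by move=> lW Wx Wy; apply: linsubD => //; exact: linsubN. Qed.

End LinearSubspace.

Section OpenMapping.
Context {R : realType} {X : completeNormedModType (Cplx R)}.
Implicit Types (G : set (X * X)) (Y : set X).

(** Range and null space are taken for bare graphs, so that enlarged, restricted or shifted graphs
    can be handled before linearity is proved. *)
Definition rng G : set X := [set y | exists x, G (x, y)].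
Definition ker G : set X := [set x | G (x, 0)].

Lemma linsub_rng G : linsub G -> linsub (rng G).
Proof.
move=> [G0 GD]; split; first by exists 0.
move=> a x y [x' Gx] [y' Gy]; exists (a *: x' + y').
exact: (GD a (_, _) (_, _)).
Qed.

Lemma linsub_ker G : linsub G -> linsub (ker G).
Proof.
move=> [G0 GD]; split; first exact: G0.
by move=> a x y Gx Gy; have := GD a _ _ Gx Gy; congr G; congr (_, _);
  rewrite /= scaler0 add0r.
Qed.

Lemma nrm_pair (p : X * X) : nrm p = Num.max (nrm p.1) (nrm p.2).
Proof.
apply: (@complexI R); rewrite -nrmE prod_normE !nrmE /Order.max ltcR.
by case: ifP.
Qed.

Lemma nrm_pair_lt (x y : X) (e : R) : nrm x < e -> nrm y < e ->
  nrm ((x, y) : X * X) < e.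
Proof. by move=> xe ye; rewrite nrm_pair gt_max xe ye. Qed.

Lemma nrm_pair_fst (p : X * X) : nrm p.1 <= nrm p.
Proof. by rewrite nrm_pair le_max lexx. Qed.

Lemma nrm_pair_snd (p : X * X) : nrm p.2 <= nrm p.
Proof. by rewrite nrm_pair le_max lexx orbT. Qed.

Lemma closed_relP G : closed G <-> forall x y,
  (forall e : R, 0 < e -> exists x' y',
     [/\ G (x', y'), nrm (x - x') < e & nrm (y - y') < e]) -> G (x, y).
Proof.
split=> [/closedP cG x y h|h].
  apply: cG => e /h[x' [y' [Gxy xe ye]]]; exists (x', y') => //.
  exact: nrm_pair_lt.
apply/closedP => -[x y] xyP; apply: h => e /xyP[[x' y'] Gxy xye].
exists x', y'; split=> //.
  exact: le_lt_trans (@nrm_pair_fst ((x, y) - (x', y'))) xye.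
exact: le_lt_trans (@nrm_pair_snd ((x, y) - (x', y'))) xye.
Qed.

(* Successive approximation: halving the residual at a cost proportional to its
   norm solves the inclusion exactly. *)
Lemma approx_solve G Y (C : R) : linsub G -> closed G -> 0 <= C ->
  (forall y, Y y -> exists p : X * X, [/\ G p, nrm p.1 <= C * nrm y,
     Y (y - p.2) & nrm (y - p.2) <= nrm y / 2]) ->
  forall y, Y y -> exists2 x, G (x, y) & nrm x <= 2 * C * nrm y.
Proof.
move=> lG /closed_relP cG C0 stepY y Yy.
have stepY' y' : exists p : X * X, Y y' -> [/\ G p, nrm p.1 <= C * nrm y',
    Y (y' - p.2) & nrm (y' - p.2) <= nrm y' / 2].
  by have [/stepY[p pP]|nY] := pselect (Y y'); [exists p|exists 0].
have [f fP] := choice stepY'.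
(* [r n] is the residual after [n] corrections and [u n] the sum of the first components used so
   far; the invariant is [G (u n, y - r n)]. *)
pose r := fix r n := if n is m.+1 then r m - (f (r m)).2 else y.
pose u := fix u n := if n is m.+1 then u m + (f (r m)).1 else 0.
have rP n : Y (r n) /\ nrm (r n) <= nrm y / 2 ^+ n.
  elim: n => [|n [Yr rn]] /=; first by rewrite expr0 divr1.
  have [_ _ Yr' rn'] := fP _ Yr; split=> //.
  by rewrite (le_trans rn')// exprSr invfM mulrA ler_pM2r ?invr_gt0.
have uP n : G (u n, y - r n).
  elim: n => [|n IH] /=; first by rewrite subrr; exact: lG.1.
  have [Gf _ _ _] := fP _ (rP n).1.
  have := linsubD lG IH Gf; rewrite [f _]surjective_pairing.
  by rewrite opprB addrCA addrC.
have [n|x xP] := @geometric_cvg_nrm R X u (C * nrm y).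
  rewrite /= addrC addKr; have [_ + _ _] := fP _ (rP n).1; move/le_trans; apply.
  by rewrite -mulrA ler_wpM2l// (rP n).2.
exists x; last by have := xP 0%N; rewrite subr0 expr0 divr1 mulrA.
apply: cG => e e0.
have [n nP] := small_geometric (2 * (C * nrm y) + nrm y) e0.
exists (u n), (y - r n); split=> //.
  apply: le_lt_trans (xP n) (le_lt_trans _ nP).
  by rewrite ler_pM2r ?invr_gt0 ?exprn_gt0// lerDl nrm_ge0.
rewrite opprB addrC subrK; apply: le_lt_trans (rP n).2 (le_lt_trans _ nP).
by rewrite ler_pM2r ?invr_gt0 ?exprn_gt0// lerDr !mulr_ge0 ?nrm_ge0.
Qed.

(** Baire's theorem relative to the closed set [Y]: some [E n] is dense in a ball of [Y]. Otherwise
    nested balls with at least halving radii can be chosen, the [n]-th step avoiding [E n], and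
    their centres converge to a point of [Y] in no [E n]. *)
Lemma Baire_closed Y (E : nat -> set X) : closed Y -> Y 0 ->
  Y `<=` \bigcup_n E n ->
  exists n y (r : R), [/\ 0 < r, Y y & forall z, Y z -> nrm (z - y) < r ->
    forall e : R, 0 < e -> exists2 w, E n w & nrm (z - w) < e].
Proof.
move=> /closedP cY Y0 YE; apply: contrapT => nP.
have step n (p : X * R) : exists q : X * R, Y p.1 -> 0 < p.2 ->
    [/\ Y q.1, 0 < q.2, q.2 <= p.2 / 2, nrm (q.1 - p.1) <= p.2 / 2 &
      (* The factor 2 keeps even the closed ball of radius [q.2] away from [E n]: the limit point
         lies within [q.2] of [q.1], which excludes it from [E n]. *)
      forall w, E n w -> 2 * q.2 <= nrm (q.1 - w)].
  have [[Yp p0]|np] := pselect (Y p.1 /\ 0 < p.2); last first.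
    by exists p => ? ?; exfalso; exact: np.
  apply: contrapT => nq; apply: nP; exists n, p.1, (p.2 / 2).
  split=> //; first by rewrite divr_gt0.
  move=> z Yz zp e e0; apply: contrapT => nw; apply: nq.
  exists (z, Num.min (p.2 / 2) (e / 2)) => _ _ /=; split=> //.
  - by rewrite lt_min !divr_gt0.
  - by rewrite ge_min lexx.
  - exact: ltW.
  move=> w Ew; rewrite leNgt; apply/negP => zw; apply: nw; exists w => //.
  apply: lt_le_trans zw _; rewrite -ler_pdivlMl//.
  by rewrite [2^-1 * e]mulrC ge_min lexx orbT.
have [f fP] := choice (fun np => step np.1 np.2).
pose a := fix a n := if n is m.+1 then f (m, a m) else ((0 : X), (1 : R)).
have aP n : Y (a n).1 /\ 0 < (a n).2.
  elim: n => [//|n [Ya a0]] /=.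
  by have [] := fP (n, a n) Ya a0.
have aS n : [/\ (a n.+1).2 <= (a n).2 / 2,
    nrm ((a n.+1).1 - (a n).1) <= (a n).2 / 2 &
      forall w, E n w -> 2 * (a n.+1).2 <= nrm ((a n.+1).1 - w)].
  by have [Ya a0] := aP n; have [] := fP (n, a n) Ya a0.
have nested n k : nrm ((a (n + k)%N).1 - (a n).1) + (a (n + k)%N).2 <= (a n).2.
  elim: k => [|k IH]; first by rewrite addn0 subrr nrm0 add0r.
  rewrite addnS; have [h1 h2 _] := aS (n + k)%N.
  have := nrmDB (a (n + k)%N).1 (a (n + k).+1).1 (a n).1.
  by move: h1 h2 IH; lra.
have ageo n : (a n).2 <= 1 / 2 ^+ n.
  elim: n => [|n IH]; first by rewrite expr0 divr1.
  have [h1 _ _] := aS n; rewrite (le_trans h1)// exprSr invfM mulrA.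
  by rewrite ler_pM2r// invr_gt0.
have [n|l lP] := @geometric_cvg_nrm R X (fun n => (a n).1) 1.
  have [_ h _] := aS n; rewrite (le_trans h)// (le_trans _ (ageo n))//.
  by have [_ h0] := aP n; move: h0; lra.
have lball n : nrm (l - (a n).1) <= (a n).2.
  apply/ler_addgt0Pr => e e0; have [k ke] := small_geometric (2 * 1) e0.
  apply: le_trans (nrmDB (a (n + k)%N).1 _ _) _; rewrite addrC lerD//.
    apply: le_trans (nested n k); rewrite lerDl ltW//.
    by have [] := aP (n + k)%N.
  apply: le_trans (lP _) (le_trans _ (ltW ke)).
  rewrite ler_pM2l// lef_pV2 ?posrE ?exprn_gt0// ler_weXn2l// ?ler1n//.
  exact: leq_addl.
have Yl : Y l.
  apply: cY => e e0; have [k ke] := small_geometric (2 * 1) e0.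
  exists (a k).1; first by have [] := aP k.
  exact: le_lt_trans (lP k) ke.
have [n _ En] := YE _ Yl; have [_ _ /(_ _ En)] := aS n.
have := lball n.+1; have [_] := aP n.+1; rewrite nrmB.
by lra.
Qed.

(** Baire's theorem is applied in the closed range to the sets of values attained at vectors of norm
    at most [n]. Translating to the origin and rescaling gives the approximate solutions that
    [approx_solve] turns into exact ones. *)
Lemma open_mapping G : linsub G -> closed G -> closed (rng G) ->
  exists2 C : R, 0 < C &
    forall y, rng G y -> exists2 x, G (x, y) & nrm x <= C * nrm y.
Proof.
move=> lG cG cR.
pose E n := [set y | exists2 x, G (x, y) & nrm x <= n%:R].
have RE : rng G `<=` \bigcup_n E n.
  move=> y [x Gxy]; exists (Num.truncn (nrm x)).+1 => //; exists x => //.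
  by rewrite ltW// truncnS_gt.
have lR := linsub_rng lG.
have [n [y0 [r [r0 Ry0 nP]]]] := Baire_closed cR lR.1 RE.
(* Approximations of [z + y0] and of [y0] by values at vectors of norm at most [n] are subtracted,
   which moves the centre of the ball to the origin. *)
have small z : rng G z -> nrm z < r -> forall e : R, 0 < e ->
    exists p : X * X, [/\ G p, nrm p.1 <= 2 * n%:R & nrm (z - p.2) < e].
  move=> Rz zr e e0; have e20 : 0 < e / 2 by rewrite divr_gt0.
  have [||w1 [x1 G1 x1n] w1e] := nP (z + y0) _ _ _ e20.
  - exact: linsubD.
  - by rewrite addrK.
  have [||w2 [x2 G2 x2n] w2e] := nP y0 _ _ _ e20.
  - by [].
  - by rewrite subrr nrm0.
  exists ((x1, w1) - (x2, w2)); split; first exact: linsubB.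
    by have := nrmD x1 (- x2); rewrite nrmN /=; move: x1n x2n; lra.
  have -> : z - ((x1, w1) - (x2, w2)).2 = (z + y0 - w1) - (y0 - w2).
    by rewrite /= !opprB !addrA [z + y0 - w1]addrAC [RHS]addrAC addrK addrAC.
  by have := nrmD (z + y0 - w1) (- (y0 - w2)); rewrite nrmN; lra.
pose C : R := 4 * n%:R / r + 1.
have n0 : 0 <= n%:R :> R by [].
have C0 : 0 < C by rewrite ltr_wpDl// divr_ge0 ?mulr_ge0 ?(ltW r0).
exists (2 * C); first by rewrite mulr_gt0.
apply: approx_solve => //; first exact: ltW.
move=> y Ry; have [->|y0'] := eqVneq y 0.
  exists 0; split; first exact: lG.1.
  - by rewrite nrm0 mulr0.
  - by rewrite subr0; exact: lR.1.
  - by rewrite subr0 nrm0 mul0r.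
have ny := nrm_gt0 y0'.
(* [rc t *: y] has norm [r / 2], inside the ball. An approximation up to [r / 4], scaled back,
   leaves a residual of at most [nrm y / 2] and costs at most [4 * n%:R / r * nrm y]. *)
pose t : R := r / (2 * nrm y).
have t0 : 0 < t by rewrite divr_gt0// mulr_gt0.
have tC0 : rc t != 0 by rewrite eq_complex /= eqxx andbT gt_eqF.
have [|||p [Gp pn pe]] := @small (rc t *: y) _ _ (r / 4).
- exact: linsubZ.
- rewrite nrmZ cabs_real gtr0_norm// /t.
  have -> : r / (2 * nrm y) * nrm y = r / 2 by field; rewrite gt_eqF.
  by move: r0; lra.
- by rewrite divr_gt0.
exists ((rc t)^-1 *: p).
have Gtp : G ((rc t)^-1 *: p) by exact: linsubZ.
have nt (x : X) : nrm ((rc t)^-1 *: x) =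
    2 * nrm y / r * nrm x.
  by rewrite nrmZ cabsV cabs_real gtr0_norm// /t invf_div.
split=> //.
- rewrite nt /C.
  apply: (@le_trans _ _ (2 * nrm y / r * (2 * n%:R))).
    by rewrite ler_wpM2l// !mulr_ge0 ?invr_ge0 ?nrm_ge0// ltW.
  rewrite [leRHS]mulrDl mul1r.
  have -> : 2 * nrm y / r * (2 * n%:R) = 4 * n%:R / r * nrm y by lra.
  by rewrite lerDl nrm_ge0.
- apply: linsubB => //; exists ((rc t)^-1 *: p).1.
  by rewrite -surjective_pairing.
- have -> : y - ((rc t)^-1 *: p).2 =
      (rc t)^-1 *: (rc t *: y - p.2).
    by rewrite scalerBr scalerA mulVf// scale1r.
  rewrite nt.
  have -> : nrm y / 2 = 2 * nrm y / r * (r / 4) by field; rewrite gt_eqF.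
  apply: ler_wpM2l; last exact: ltW.
  by rewrite !mulr_ge0 ?invr_ge0 ?nrm_ge0// ltW.
Qed.

End OpenMapping.

(** * Norming functionals *)

Section HahnBanach.
Context {R : realType} {V : normedModType (Cplx R)}.
Implicit Types (x y : V) (t a b : R) (F : set (V * R)).

Local Lemma nrm_rc t x : nrm (rc t *: x) = `|t| * nrm x.
Proof. by rewrite nrmZ cabs_real. Qed.

(* Real-linear functionals dominated by the norm, encoded by their graphs. *)
Let dominated v F := [/\ F !=set0 -> F (v, nrm v),
  forall t x y a b, F (x, a) -> F (y, b) -> F (rc t *: x + y, t * a + b) &
  forall x a, F (x, a) -> a <= nrm x].

(** Hahn-Banach by Zorn's lemma on graphs. The condition [F !=set0] in [dominated] admits the empty
    graph, which is the union of the empty chain. *)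
Lemma real_norming_functional v : exists u : V -> R,
  [/\ forall t x y, u (rc t *: x + y) = t * u x + u y,
      forall x, u x <= nrm x & u v = nrm v].
Proof.
have [|A [[Av AD Adom] Amax]] := @Zorn_bigcup _ (dominated v).
  move=> F FP totF; split.
  - move=> [p [G FG Gp]]; exists G => //.
    by have [+ _ _] := FP _ FG; apply; exists p.
  - move=> t x y a b [G FG Gx] [H FH Hy].
    have [GH|HG] := totF _ _ FG FH.
      by exists H => //; have [_ + _] := FP _ FH; apply=> //; exact: GH.
    by exists G => //; have [_ + _] := FP _ FG; apply=> //; exact: HG.
  - by move=> x a [G FG Gx]; have [_ _] := FP _ FG; apply.
(* A maximal graph is not empty, since the graph on the real line spanned by [v] would strictly
   extend it. *)
have {}Av : A (v, nrm v).
  apply: contrapT => nAv.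
  apply: (Amax [set (rc t *: v, t * nrm v) | t in setT]).
    split; first by move=> p Ap; exfalso; apply: nAv; apply: Av; exists p.
    move=> sub; apply: nAv; apply: sub; exists 1 => //.
    by rewrite mul1r rc1 scale1r.
  split.
  - by move=> _; exists 1 => //; rewrite mul1r rc1 scale1r.
  - move=> t x y a b [s _ [<- <-]] [s' _ [<- <-]]; exists (t * s + s') => //.
    by rewrite rcD rcM scalerDl scalerA mulrDl mulrA.
  - move=> x a [t _ [<- <-]]; rewrite nrm_rc ler_wpM2r ?nrm_ge0//.
    exact: ler_norm.
have A0 : A (0, 0).
  have := AD (- 1) _ _ _ _ Av Av.
  by rewrite mulN1r addNr rcN rc1 scaleN1r addNr.
have AZ t x a : A (x, a) -> A (rc t *: x, t * a).
  by move=> Ax; have := AD t _ _ _ _ Ax A0; rewrite !addr0.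
have Atot x0 : exists a, A (x0, a).
  apply: contrapT => nx0.
  (* Every lower constraint on a value at [x0] lies below every upper one, so the supremum [t] of
     the lower constraints is an admissible value. *)
  have sep x y a b : A (x, a) -> A (y, b) ->
      a - nrm (x - x0) <= nrm (y + x0) - b.
    move=> Ax Ay; have := AD 1 _ _ _ _ Ax Ay.
    rewrite rc1 scale1r mul1r => /Adom.
    have := nrmD (x - x0) (y + x0).
    rewrite addrACA addNr addr0; lra.
  pose S := [set a | exists x b, A (x, b) /\ a = b - nrm (x - x0)].
  have Sub y b : A (y, b) -> ubound S (nrm (y + x0) - b).
    by move=> Ay _ [x [a [Ax ->]]]; exact: sep.
  have supS : has_sup S.
    split; last by exists (nrm (0 + x0) - 0); exact: Sub.
    by exists (0 - nrm (0 - x0)), 0, 0.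
  pose t := sup S.
  have tge x a : A (x, a) -> a - nrm (x - x0) <= t.
    by move=> Ax; apply: sup_upper_bound => //; exists x, a.
  have tle y b : A (y, b) -> t <= nrm (y + x0) - b.
    by move=> Ay; apply: ge_sup; [case: supS|exact: Sub].
  apply: (Amax [set p | exists x a s,
      A (x, a) /\ p = (x + rc s *: x0, a + s * t)]).
    split.
      by move=> [x a] Ax; exists x, a, 0; rewrite rc0 scale0r addr0 mul0r addr0.
    move=> sub; apply: nx0; exists t; apply: sub; exists 0, 0, 1.
    by rewrite rc1 scale1r mul1r !add0r.
  split.
  - move=> _; exists v, (nrm v), 0.
    by rewrite rc0 scale0r addr0 mul0r addr0.
  - move=> r x y a b [x' [a' [s [Ax [-> ->]]]]] [y' [b' [s' [Ay [-> ->]]]]].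
    exists (rc r *: x' + y'), (r * a' + b'), (r * s + s').
    split; first exact: AD.
    by rewrite rcD rcM scalerDr scalerDl scalerA addrACA; congr (_, _); ring.
  move=> x a [x' [a' [s [Ax [-> ->]]]]].
  (* Dividing by [|s|] reduces domination at [x' + rc s *: x0] to the upper constraint [tle] when
     [s > 0] and to the lower constraint [tge] when [s < 0]. *)
  have [s0|s0|->] := ltgtP s 0; last first.
  - by rewrite rc0 scale0r addr0 mul0r addr0; exact: Adom.
  - have -> : x' + rc s *: x0 = rc s *: (rc s^-1 *: x' + x0).
      by rewrite scalerDr scalerA -rcM divff ?gt_eqF// rc1 scale1r.
    have := tle _ _ (AZ s^-1 _ _ Ax).
    rewrite nrm_rc gtr0_norm// -(ler_pM2l s0) mulrBr mulrA divff ?gt_eqF//.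
    by rewrite mul1r; lra.
  - have -> : x' + rc s *: x0 = rc (- s) *: (rc (- s)^-1 *: x' - x0).
      rewrite scalerBr scalerA -rcM divff ?oppr_eq0 ?lt_eqF// rc1 scale1r.
      by rewrite -scaleNr -rcN opprK.
    have := tge _ _ (AZ (- s)^-1 _ _ Ax).
    have s0' : 0 < - s by rewrite oppr_gt0.
    rewrite nrm_rc gtr0_norm// -(ler_pM2l s0') mulrBr mulrA divff ?gt_eqF//.
    by rewrite mul1r; lra.
have Auniq x a b : A (x, a) -> A (x, b) -> a = b.
  suff le c d : A (x, c) -> A (x, d) -> c <= d.
    by move=> Aa Ab; apply/eqP; rewrite eq_le !le.
  move=> Ac Ad; have := AD (- 1) _ _ _ _ Ad Ac.
  by rewrite rcN rc1 scaleN1r addNr mulN1r => /Adom; rewrite nrm0; lra.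
have [u uP] := choice Atot.
exists u; split.
- by move=> t x y; apply: Auniq (uP _) _; exact: AD.
- by move=> x; apply: Adom.
- exact: Auniq (uP _) Av.
Qed.

(** The real functional [u] is complexified as [u x - i u (i x)] and divided by its value at [v],
    which is nonzero because its real part is [nrm v]. Bounding real and imaginary parts separately
    gives the factor 2. *)
Lemma separating_functional v : v != 0 -> exists f : V -> Cplx R,
  [/\ forall c x y, f (c *: x + y) = c * f x + f y, f v = 1 &
      exists2 K : R, 0 <= K & forall x, cabs (f x) <= K * nrm x].
Proof.
move=> v0; have [u [uL udom uv]] := real_norming_functional v.
have uD x y : u (x + y) = u x + u y.
  by rewrite -[x in LHS]scale1r -rc1 uL mul1r.
have u0 : u 0 = 0 by have := uD 0 0; rewrite addr0; lra.
have uZ t x : u (rc t *: x) = t * u x by rewrite -[_ *: _]addr0 uL u0 addr0.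
have uN x : u (- x) = - u x by rewrite -scaleN1r -rc1 -rcN uZ mulN1r.
have uabs x : `|u x| <= nrm x.
  by rewrite ler_norml udom andbT lerNl -uN (le_trans (udom _))// nrmN.
pose I : Cplx R := 'i%C.
pose g x : Cplx R := Complex (u x) (- u (I *: x)).
have II x : I *: (I *: x) = - x.
  by rewrite scalerA -scaleN1r -expr2 [I ^+ 2]sqr_i.
have gL c x y : g (c *: x + y) = c * g x + g y.
  have -> : c *: x = rc (complex.Re (c : complex R)) *: x +
      rc (complex.Im (c : complex R)) *: (I *: x).
    rewrite scalerA -scalerDl; congr (_ *: _); rewrite mulrC; exact: complexE.
  rewrite /g !scalerDr [I *: (rc _ *: x)]scalerA [I * rc _]mulrC.
  rewrite -[X in X + _ + _]scalerA [I *: (rc _ *: (I *: x))]scalerA.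
  rewrite [I * rc _]mulrC -[X in _ + X + _]scalerA II.
  rewrite !uD !uZ uN.
  case: c => a b; apply/eqP; rewrite eq_complex /=.
  by apply/andP; split; apply/eqP; ring.
have gv0 : g v != 0.
  by rewrite eq_complex /= uv negb_and gt_eqF// nrm_gt0.
exists (fun x => (g v)^-1 * g x); split.
- by move=> c x y; rewrite gL mulrDr mulrCA.
- by rewrite mulVf.
exists ((cabs (g v))^-1 * 2); first by rewrite mulr_ge0// invr_ge0 cabs_ge0.
move=> x; rewrite cabsM cabsV -mulrA ler_wpM2l ?invr_ge0 ?cabs_ge0//.
apply: le_trans (cabs_ReIm _) _; rewrite /= normrN.
by have := uabs x; have := uabs (I *: x); rewrite nrmZ cabs_i; lra.
Qed.

End HahnBanach.

(** * Stability under small scalar perturbations *)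

Section AddLine.
Context {K : fieldType} {V : lmodType K}.
Implicit Types (W : set V) (s : seq V).

Definition addline W v : set V := [set x | exists c : K, W (x - c *: v)].

(** The subspace [W + span s]. The base [W] is an accumulator, so that an induction on [s] may
    absorb one vector at a time into [W]. *)
Fixpoint lincomb W s : set V :=
  if s is v :: s' then lincomb (addline W v) s' else W.

Lemma sub_addline W v : W `<=` addline W v.
Proof. by move=> x Wx; exists 0; rewrite scale0r subr0. Qed.

Lemma linsub_addline W v : linsub W -> linsub (addline W v).
Proof.
move=> lW; split; first by apply: sub_addline; exact: lW.1.
move=> a x y [c Wx] [d Wy]; exists (a * c + d); have := lW.2 a _ _ Wx Wy.
by rewrite scalerBr scalerA scalerDl opprD addrACA.
Qed.

Lemma addline_id W v : linsub W -> W v -> addline W v = W.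
Proof.
move=> lW Wv; apply/seteqP; split; last exact: sub_addline.
move=> x [c Wx]; rewrite -(subrK (c *: v) x).
by apply: linsubD => //; exact: linsubZ.
Qed.

Lemma addlineAC W u v : addline (addline W u) v = addline (addline W v) u.
Proof.
by apply/seteqP; split=> x [c [d Wx]]; exists d, c; rewrite addrAC.
Qed.

Lemma lincomb_addline W s u c x :
  lincomb W s (x - c *: u) -> lincomb (addline W u) s x.
Proof.
elim: s W => [|v s IH] W /=; first by exists c.
by move=> /IH; rewrite addlineAC.
Qed.

End AddLine.

Lemma lincomb_map (K : fieldType) (V V' : lmodType K) (g : V -> V')
    (W : set V) (W' : set V') (s : seq V) :
  (forall a x y, g (a *: x + y) = a *: g x + g y) ->
  (forall x, W x -> W' (g x)) ->
  forall x, lincomb W s x -> lincomb W' (map g s) (g x).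
Proof.
move=> gL; elim: s W W' => [|v s IH] W W' WW' x /=; first exact: WW'.
apply: IH => {}x [c Wx]; exists c.
suff -> : g x - c *: g v = g (x - c *: v) by exact: WW'.
by rewrite [x - _]addrC -[- (c *: v)]scaleNr gL scaleNr addrC.
Qed.

Section ClosedAddLine.
Context {R : realType} {V : normedModType (Cplx R)}.
Implicit Types W : set V.

(** A vector [v] outside [W] has positive distance [d] from [W], hence
    [cabs c * d <= nrm (c *: v - w)] for [w] in [W]: the coefficients of a convergent sequence in
    [W + span v] converge too. *)
Lemma closed_addline W v : linsub W -> closed W -> closed (addline W v).
Proof.
move=> lW cW; have [Wv|nWv] := pselect (W v); first by rewrite addline_id.
have /closedP cW' := cW.
have [d d0 dP] : exists2 d : R, 0 < d & forall w, W w -> d <= nrm (v - w).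
  apply: contrapT => nd; apply: nWv; apply: cW' => e e0.
  apply: contrapT => nw; apply: nd; exists e => // w Ww.
  by rewrite leNgt; apply/negP => vw; apply: nw; exists w.
have sep c w : W w -> cabs c * d <= nrm (c *: v - w).
  move=> Ww; have [->|c0] := eqVneq c 0.
    by rewrite cabs0 mul0r nrm_ge0.
  have -> : c *: v - w = c *: (v - c^-1 *: w).
    by rewrite scalerBr scalerA divff// scale1r.
  by rewrite nrmZ ler_wpM2l ?cabs_ge0// dP//; exact: linsubZ.
apply/closedP => x xP.
have step n : exists p : V * Cplx R,
    W (p.1 - p.2 *: v) /\ nrm (x - p.1) < 1 / 2 ^+ n.
  have [|y [c Wy] yn] := xP (1 / 2 ^+ n); first by rewrite divr_gt0// exprn_gt0.
  by exists (y, c).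
have [f fP] := choice step.
(* Consecutive approximants of [x] differ by at most [2 / 2 ^+ n]; dividing by [d] bounds the
   difference of their coefficients. *)
have [n|c cP] := @geometric_cvgC R (fun n => (f n).2) (2 / d).
  have [W1 y1] := fP n; have [W2 y2] := fP n.+1.
  have := sep ((f n.+1).2 - (f n).2) _ (linsubB lW W1 W2).
  have -> : ((f n.+1).2 - (f n).2) *: v -
      ((f n).1 - (f n).2 *: v - ((f n.+1).1 - (f n.+1).2 *: v)) =
      (f n.+1).1 - (f n).1.
    apply/eqP; rewrite scalerBl subr_eq addrA subrKA opprB.
    by rewrite [eqbRHS]addrC subrKA.
  have := nrmDB x (f n.+1).1 (f n).1.
  rewrite [nrm (_ - x)]nrmB => h1 h2.
  rewrite mulrAC ler_pdivlMr//; apply: le_trans h2 (le_trans h1 _).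
  have : 1 / 2 ^+ n.+1 <= 1 / 2 ^+ n :> R.
    by rewrite ler_pM2l// lef_pV2 ?posrE ?exprn_gt0// ler_weXn2l// ler1n.
  by move: y1 y2; lra.
exists c; apply: cW' => e e0.
have [n nP] := small_geometric (1 + 4 * (2 / d) * nrm v) e0.
have [Wn yn] := fP n; exists ((f n).1 - (f n).2 *: v) => //.
apply: le_lt_trans nP.
have -> : x - c *: v - ((f n).1 - (f n).2 *: v) =
    (x - (f n).1) - (c - (f n).2) *: v.
  by rewrite scalerBl !opprB addrACA [- _ - _]addrC addrACA.
apply: le_trans (nrmD _ _) _; rewrite nrmN nrmZ mulrDl.
apply: lerD; first exact: ltW.
by rewrite mulrAC ler_wpM2r ?nrm_ge0.
Qed.

End ClosedAddLine.

Section Stability.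
Context {R : realType} {X : completeNormedModType (Cplx R)}.
Implicit Types (G : set (X * X)) (e : Cplx R) (s : seq X).

(* The relation [G + e]; on graphs of [l - T] it gives [(l + e) - T]. *)
Definition shiftG e G : set (X * X) := [set p | G (p.1, p.2 - e *: p.1)].

Lemma linsub_shiftG e G : linsub G -> linsub (shiftG e G).
Proof.
move=> lG; split; first by rewrite /shiftG /= scaler0 subr0; exact: lG.1.
move=> a x y Gx Gy; have := lG.2 a _ _ Gx Gy; rewrite /shiftG /=.
congr G; congr (_, _).
rewrite -[LHS]/(a *: (x.2 - e *: x.1) + (y.2 - e *: y.1)).
by rewrite scalerBr scalerDr opprD !scalerA [e * a]mulrC addrACA.
Qed.

Lemma closed_shiftG e G : closed G -> closed (shiftG e G).
Proof.
move=> /closed_relP cG; apply/closed_relP => x y h; apply: cG => r r0.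
have c0 : 0 < 1 + cabs e by rewrite ltr_pwDl// cabs_ge0.
have [|x' [y' [Gxy xx yy]]] := h (r / (1 + cabs e)); first by rewrite divr_gt0.
exists x', (y' - e *: x'); split=> //=.
  apply: lt_le_trans xx _; rewrite ler_pdivrMr//.
  by apply: ler_peMr; [exact: ltW|rewrite lerDl cabs_ge0].
have -> : y - e *: x - (y' - e *: x') = (y - y') - e *: (x - x').
  by rewrite scalerBr !opprB addrACA [- _ - _]addrC addrACA.
apply: le_lt_trans (nrmD _ _) _; rewrite nrmN nrmZ.
have -> : r = r / (1 + cabs e) + cabs e * (r / (1 + cabs e)).
  by field; rewrite gt_eqF.
by rewrite ltr_leD// ler_wpM2l ?cabs_ge0// ltW.
Qed.

(** The lower bound turns a Cauchy sequence of values into a Cauchy sequence of preimages, and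
    closedness of [G] passes to the limit. *)
Lemma closed_rng_below G (C : R) : linsub G -> closed G -> 0 <= C ->
  (forall x y, G (x, y) -> nrm x <= C * nrm y) -> closed (rng G).
Proof.
move=> lG /closed_relP cG C0 GC; apply/closedP => y yP.
have step n : exists p, G p /\ nrm (y - p.2) < 1 / 2 ^+ n.
  have [|z [x Gx] zn] := yP (1 / 2 ^+ n); first by rewrite divr_gt0// exprn_gt0.
  by exists (x, z).
have [f fP] := choice step.
have [n|x xP] := @geometric_cvg_nrm R X (fun n => (f n).1) (C * 2).
  have [G1 y1] := fP n; have [G2 y2] := fP n.+1.
  apply: le_trans (GC _ ((f n.+1).2 - (f n).2) _) _.
    by have := linsubB lG G2 G1; rewrite [f n]surjective_pairing
      [f n.+1]surjective_pairing.
  rewrite -mulrA ler_wpM2l//.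
  have := nrmDB y (f n.+1).2 (f n).2; rewrite [nrm (_ - y)]nrmB.
  have : 1 / 2 ^+ n.+1 <= 1 / 2 ^+ n :> R.
    by rewrite ler_pM2l// lef_pV2 ?posrE ?exprn_gt0// ler_weXn2l// ler1n.
  by move: y1 y2; lra.
exists x; apply: cG => e e0.
have [n nP] := small_geometric (2 * (C * 2) + 1) e0.
have [Gn yn] := fP n; exists (f n).1, (f n).2; split.
- by rewrite -surjective_pairing.
- apply: le_lt_trans (xP n) (le_lt_trans _ nP).
  by rewrite ler_pM2r ?invr_gt0 ?exprn_gt0// lerDl.
- apply: lt_trans yn (le_lt_trans _ nP).
  by rewrite ler_pM2r ?invr_gt0 ?exprn_gt0// lerDr !mulr_ge0.
Qed.

Lemma rng_addline G w : rng (addline G (0, w)) = addline (rng G) w.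
Proof.
apply/seteqP; split=> y.
  move=> [x [c Gx]]; exists c, x; move: Gx; congr G.
  by congr (_, _); rewrite /= scaler0 subr0.
move=> [c [x Gx]]; exists x, c; move: Gx; congr G.
by congr (_, _); rewrite /= scaler0 subr0.
Qed.

(* If [y - c w] is in the range and [y] is a limit of [y_k] in the range, then
   lifting [y_k - y] along the enlarged relation by small vectors shows that
   [(0, c w)] is a limit of elements of [G]. *)
Lemma closed_rng_addline G w : linsub G -> closed G ->
  closed (addline (rng G) w) -> closed (rng G).
Proof.
move=> lG cG cR; have [Rw|nRw] := pselect (rng G w).
  by move: cR; rewrite addline_id//; exact: linsub_rng.
have lR := linsub_rng lG.
have [] := @open_mapping R X (addline G (0, w)).
- exact: linsub_addline.
- exact: closed_addline.
- by rewrite rng_addline.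
move=> C C0 CP; rewrite rng_addline in CP.
have /closedP cR' := cR.
apply/closedP => y yP.
have [c Ryc] : addline (rng G) w y.
  by apply: cR' => e /yP[z Rz yz]; exists z => //; exact: sub_addline.
suff Gcw : G (0, c *: w).
  by rewrite -(subrK (c *: w) y); apply: linsubD => //; exists 0.
move/closed_relP : cG; apply => e e0.
have D0 : 0 < 1 + C by rewrite ltr_wpDl.
have [|z Rz yz] := yP (e / (1 + C)); first by rewrite divr_gt0.
have Az : addline (rng G) w (z - y).
  apply: linsubB; first exact: linsub_addline.
    exact: sub_addline.
  by exists c.
have [x [d Gx] xz] := CP _ Az.
have {}Gx : G (x, z - y - d *: w).
  by move: Gx; congr G; congr (_, _); rewrite /= scaler0 subr0.
(* Otherwise a nonzero multiple of [w], hence [w] itself, would be in the range. *)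
have cd : c + d = 0.
  apply: contrapT => /eqP cd; apply: nRw.
  suff : rng G ((c + d) *: w).
    by move=> /(linsubZ (c + d)^-1 lR); rewrite scalerA mulVf// scale1r.
  have -> : (c + d) *: w = z - (y - c *: w) - (z - y - d *: w).
    rewrite scalerDl [- (y - _)]opprB [c *: w - y]addrC addrA opprB.
    by rewrite [RHS]addrC subrKA addrC.
  by apply: linsubB => //; [exact: linsubB|exists x].
have {}cd : d = - c by rewrite -[RHS]addr0 -cd addKr.
rewrite cd scaleNr opprK in Gx.
exists x, (z - y + c *: w); split => //.
  rewrite sub0r nrmN; apply: le_lt_trans xz _; rewrite nrmB.
  apply: (@le_lt_trans _ _ (C * (e / (1 + C)))).
    by rewrite ler_wpM2l// ltW.
  by rewrite mulrCA gtr_pMr// ltr_pdivrMr// mul1r ltrDr.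
rewrite opprD addrCA subrr addr0 opprB; apply: lt_le_trans yz _.
by rewrite ler_pdivrMr//; apply: ler_peMr; rewrite ?lerDl; exact: ltW.
Qed.

(** Solving for [G] instead of [G + e] leaves the residual [- e *: x], of norm at most
    [cabs e * C * nrm y']. For [cabs e < 1 / (2 * C)] this is at most half of [nrm y'], as
    [approx_solve] requires. *)
Lemma surjective_stable G : linsub G -> closed G -> rng G = setT ->
  exists2 d : R, 0 < d & forall e, cabs e < d -> rng (shiftG e G) = setT.
Proof.
move=> lG cG RG; have cR : closed (rng G) by rewrite RG; exact: closedT.
have [C C0 CP] := open_mapping lG cG cR.
exists (1 / (2 * C)); first by rewrite divr_gt0// mulr_gt0.
move=> e; rewrite ltr_pdivlMr ?mulr_gt0// => eC.
apply/seteqP; split=> // y _.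
have [|||y' _||x Gx _] := @approx_solve R X (shiftG e G) setT C _ _ _ _ y.
- exact: linsub_shiftG.
- exact: closed_shiftG.
- exact: ltW.
- have [|x Gx xy] := CP y'; first by rewrite RG.
  exists (x, y' + e *: x); split=> //.
    by rewrite /shiftG /= addrK.
  rewrite /= opprD addNKr nrmN nrmZ.
  apply: (@le_trans _ _ (cabs e * (C * nrm y'))).
    by rewrite ler_wpM2l ?cabs_ge0.
  rewrite mulrA [leRHS]mulrC ler_wpM2r ?nrm_ge0//.
  by move: eC; lra.
- by [].
- by exists x.
Qed.

(** Injectivity and open mapping give [nrm x <= C * nrm y] on [G]. A perturbation with
    [cabs e < 1 / (2 * C)] only doubles the constant, and such a bound yields both conclusions. *)
Lemma injective_stable G : linsub G -> closed G -> closed (rng G) ->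
  ker G `<=` [set 0] ->
  exists2 d : R, 0 < d & forall e, cabs e < d ->
    ker (shiftG e G) `<=` [set 0] /\ closed (rng (shiftG e G)).
Proof.
move=> lG cG cR kG; have [C C0 CP] := open_mapping lG cG cR.
have below x y : G (x, y) -> nrm x <= C * nrm y.
  move=> Gx; have [|x' Gx' xy] := CP y; first by exists x.
  suff -> : x = x' by [].
  apply/eqP; rewrite -subr_eq0; apply/eqP/kG.
  by have := linsubB lG Gx Gx'; congr G; congr (_, _); exact: subrr.
exists (1 / (2 * C)); first by rewrite divr_gt0// mulr_gt0.
move=> e; rewrite ltr_pdivlMr ?mulr_gt0// => eC.
have below' x y : shiftG e G (x, y) -> nrm x <= 2 * C * nrm y.
  move=> /below /=; have := nrmD y (- (e *: x)); rewrite nrmN nrmZ => h1 h2.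
  have : C * nrm (y - e *: x) <= C * (nrm y + cabs e * nrm x).
    by rewrite ler_wpM2l// ltW.
  have : 2 * cabs e * C * nrm x <= 1 * nrm x.
    by rewrite ler_wpM2r ?nrm_ge0//; move: eC; lra.
  by move: h2; lra.
split.
  by move=> x /below'; rewrite nrm0 mulr0 => x0; apply: nrm0_eq0; apply/eqP;
    rewrite eq_le x0 nrm_ge0.
apply: closed_rng_below below'.
- exact: linsub_shiftG.
- exact: closed_shiftG.
- by rewrite mulr_ge0// ltW.
Qed.

Lemma shiftG_addline e G w :
  shiftG e (addline G (0, w)) = addline (shiftG e G) (0, w).
Proof.
by apply/seteqP; split=> -[x y] [c Gx]; exists c; move: Gx; congr G;
  congr (_, _); rewrite /= scaler0 subr0 addrAC.
Qed.

(** Induction on [s]: adding [(0, w)] to [G] adds [w] to the range and commutes with [shiftG e].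
    Closedness of the range descends again by [closed_rng_addline]. *)
Lemma cofinite_range_stable s G : linsub G -> closed G -> closed (rng G) ->
  lincomb (rng G) s = setT ->
  exists2 d : R, 0 < d & forall e, cabs e < d ->
    closed (rng (shiftG e G)) /\
    exists s', lincomb (rng (shiftG e G)) s' = setT.
Proof.
elim: s G => [|w s IH] G lG cG cR /= sG.
  have [d d0 dP] := surjective_stable lG cG sG.
  by exists d => // e /dP Re; split; [rewrite Re; exact: closedT|exists [::]].
have [||||d d0 dP] := IH (addline G (0, w)).
- exact: linsub_addline.
- exact: closed_addline.
- by rewrite rng_addline; apply: closed_addline => //; exact: linsub_rng.
- by rewrite rng_addline.
exists d => // e /dP; rewrite shiftG_addline rng_addline => -[cRe [s' s'P]].
split; last by exists (w :: s').
apply: closed_rng_addline cRe; first exact: linsub_shiftG.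
exact: closed_shiftG.
Qed.

Lemma finite_kernel_stable s G : linsub G -> closed G -> closed (rng G) ->
  (forall v, v \in s -> ker G v) -> ker G `<=` lincomb [set 0] s ->
  exists2 d : R, 0 < d & forall e, cabs e < d ->
    closed (rng (shiftG e G)) /\ exists s',
    (forall v, v \in s' -> ker (shiftG e G) v) /\
    ker (shiftG e G) `<=` lincomb [set 0] s'.
Proof.
(* The induction is on the length, because the recursive call uses the projected list [map proj s]
   and not a tail of [s]. *)
elim: {s}(size s) {-2}s (erefl (size s)) G
  => [|n IH] [|v s]//= ns G lG cG cR sG kG.
  have [d d0 dP] := injective_stable lG cG cR kG.
  by exists d => // e /dP[ke ce]; split=> //; exists [::].
have lin0 : linsub [set (0 : X)].
  by split=> // a x y -> ->; rewrite scaler0 addr0.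
case: ns => ns; have [v0|v0] := eqVneq v 0.
  apply: (IH s) => //; first by move=> u us; apply: sG; rewrite inE us orbT.
  by move=> x /kG; rewrite v0 addline_id.
(* [G'] is the restriction of [G] to the hyperplane [f = 0]: it has the same
   range as [G], and one dimension less in its null space. *)
have [f [fL fv [K K0 fK]]] := separating_functional v0.
have f0 : f 0 = 0 by have := fL 1 0 0; rewrite scaler0 addr0 mul1r => /eqP;
  rewrite -subr_eq0 opprD addNKr oppr_eq0 => /eqP.
have fZ c x : f (c *: x) = c * f x by rewrite -[_ *: _]addr0 fL f0 addr0.
have fB x y : f (x - y) = f x - f y.
  by rewrite addrC -scaleN1r fL mulN1r addrC.
pose proj x := x - f x *: v.
have projL a x y : proj (a *: x + y) = a *: proj x + proj y.
  by rewrite /proj fL scalerDl scalerBr scalerA opprD addrACA.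
have fproj x : f (proj x) = 0 by rewrite /proj fB fZ fv mulr1 subrr.
pose G' : set (X * X) := [set p | G p /\ f p.1 = 0].
have Gv c : G (c *: v, 0).
  have := linsubZ c lG (sG v (mem_head _ _)); congr G.
  by congr (_, _); exact: scaler0.
have Gproj x y : G (x, y) -> G' (proj x, y).
  move=> Gx; split; last exact: fproj.
  by have := linsubB lG Gx (Gv (f x)); congr G; congr (_, _); rewrite /= subr0.
have lG' : linsub G'.
  split; first by split; [exact: lG.1|exact: f0].
  move=> a x y [Gx fx] [Gy fy]; split; first exact: lG.2.
  by rewrite /= fL fx fy mulr0 addr0.
have cG' : closed G'.
  apply/closed_relP => x y h; split.
    move/closed_relP : cG; apply => e /h[x' [y' [[Gx _] xx yy]]].
    by exists x', y'.
  apply: (@nrm0_eq0 R (Cplx R)^o); apply/eqP; rewrite eq_le nrm_ge0 andbT.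
  apply/ler_addgt0Pr => e e0; rewrite add0r.
  have K1 : 0 < 1 + K by rewrite ltr_pwDl.
  have [|x' [y' [[_ /= fx'] xx yy]]] := h (e / (1 + K)).
    by rewrite divr_gt0.
  rewrite nrm_cabs -[f x]subr0 -fx' -fB (le_trans (fK _))//.
  apply: le_trans (ler_wpM2l K0 (ltW xx)) _.
  by rewrite mulrCA ler_piMr ?ltW// ltr_pdivrMr// mul1r ltrDr.
have RG' : rng G' = rng G.
  apply/seteqP; split=> y [x Gx]; last by exists (proj x); exact: Gproj.
  by exists x; case: Gx.
have [||||d d0 dP] := IH (map proj s) _ G' lG' cG'.
- by rewrite size_map.
- by rewrite RG'.
- by move=> _ /mapP[u us ->]; apply: Gproj; apply: sG; rewrite inE us orbT.
- move=> x [/kG /= kx fx].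
  have -> : x = proj x by rewrite /proj fx scale0r subr0.
  apply: lincomb_map kx => // z [c /eqP].
  rewrite subr_eq0 => /eqP ->.
  by rewrite /proj fZ fv mulr1 subrr.
exists d => // e /dP[cRe [s' [s'G s'P]]].
have shv c : shiftG e G (c *: v, c *: (e *: v)).
  by rewrite /shiftG /= !scalerA [e * c]mulrC subrr.
have lS := linsub_shiftG e lG.
(* Every [x] splits as [proj x + f x *: v], and [v] is sent to [e *: v] by [G + e]; so restricting
   to the hyperplane loses at most this one direction of the range. *)
have RE : rng (shiftG e G) = addline (rng (shiftG e G')) (e *: v).
  apply/seteqP; split=> y.
    move=> [x Gx]; exists (f x), (proj x).
    rewrite /shiftG /=; have := Gproj _ _ Gx; congr G'; congr (_, _) => /=.
    by rewrite /proj scalerBr !scalerA [e * _]mulrC opprB subrKA.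
  move=> [c [x [Gx _]]]; exists (x + c *: v).
  rewrite -[y](subrK (c *: (e *: v))).
  exact: (linsubD lS (Gx : shiftG e G (x, y - c *: (e *: v))) (shv c)).
split.
  rewrite RE; apply: closed_addline => //; apply: linsub_rng.
  exact: linsub_shiftG.
(* The null space of the shifted [G] exceeds that of the shifted [G'] by at most one dimension,
   spanned by any [u] in it with [f u <> 0]. *)
have [[u [Gu fu]]|nu] := pselect (exists u, ker (shiftG e G) u /\ f u <> 0).
  exists (u :: s'); split.
    move=> x; rewrite inE => /predU1P[->//|/s'G]; by case.
  move=> x Gx /=; apply: (@lincomb_addline _ _ _ _ _ (f x / f u)).
  apply: s'P; split; last first.
    by rewrite /= fB fZ divfK ?subrr//; exact/eqP.
  apply: (linsubB (linsub_ker lS)) => //.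
  by apply: linsubZ => //; exact: linsub_ker.
exists s'; split; first by move=> x /s'G; case.
move=> x Gx; apply: s'P; split=> //=.
by apply: contrapT => fx; apply: nu; exists x.
Qed.

End Stability.

(** * Semi-Fredholm relations *)

Section QuotientBasis.
Context {K : fieldType} {V : lmodType K}.
Implicit Types (U W : set V) (s : seq V).

Lemma lincombP W s x : lincomb W s x <->
  exists c : 'I_(size s) -> K, W (x - \sum_i c i *: s`_i).
Proof.
elim: s W => [|v s IH] W /=.
  split=> [Wx|[c]]; last by rewrite big_ord0 subr0.
  by exists (fun=> 0); rewrite big_ord0 subr0.
rewrite IH; split=> [[c [a Wx]]|[c Wx]].
  exists (fun i => oapp c a (unlift ord0 i)); move: Wx; congr W.
  rewrite big_ord_recl unlift_none /= opprD [- (a *: v) - _]addrC addrA.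
  by congr (_ - _ - _); apply: eq_bigr => i _; rewrite liftK.
exists (fun i => c (lift ord0 i)), (c ord0); move: Wx; congr W.
by rewrite big_ord_recl /= opprD [- (_ *: v) - _]addrC addrA.
Qed.

(** The tail is first thinned out modulo [W + span v]; then [v] itself is kept exactly when it is
    outside [W]. *)
Lemma independent_subsequence W s : linsub W -> exists b,
  [/\ {subset b <= s}, lincomb W b = lincomb W s &
      forall c : 'I_(size b) -> K, W (\sum_i c i *: b`_i) -> forall i, c i = 0].
Proof.
elim: s W => [|v s IH] W lW.
  by exists [::]; split=> // c _ [].
have [b [bs sb indb]] := IH _ (linsub_addline v lW).
have [Wv|nWv] := pselect (W v).
  exists b; split=> [u /bs us|/=|]; first by rewrite inE us orbT.
    by rewrite -sb addline_id.
  by move: indb; rewrite addline_id.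
exists (v :: b); split=> [u|//|c].
  by rewrite !inE => /predU1P[->|/bs ->]; rewrite ?eqxx ?orbT.
rewrite big_ord_recl /= => Wc.
have c1 : forall i, c (lift ord0 i) = 0.
  apply: indb; exists (- c ord0).
  by rewrite scaleNr opprK addrC.
have c0 : c ord0 = 0.
  apply: contrapT => /eqP c0; apply: nWv.
  move: Wc; rewrite big1 ?addr0; last by move=> i _; rewrite c1 scale0r.
  by move=> /(linsubZ (c ord0)^-1 lW); rewrite scalerA mulVf// scale1r.
by move=> i; case: (unliftP ord0 i) => [j ->|->].
Qed.

(** Finite dimension is traded for a spanning list, so that the stability arguments need not
    maintain linear independence. *)
Lemma quotient_dim_lt_pinfty U W : linsub U -> linsub W ->
  (quotient_dim U W < +oo)%E <->
  exists s, (forall v, v \in s -> U v) /\ U `<=` lincomb W s.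
Proof.
move=> lU lW; rewrite /quotient_dim; split.
  case: asboolP => [[n [v [Uv _ genv]]] _|//].
  exists (codom v); split; first by move=> _ /codomP[i ->].
  move=> x /genv[c Wc]; apply/lincombP.
  have sE : size (codom v) = n by rewrite size_codom card_ord.
  have vE (j : 'I_n) : v j = (codom v)`_j.
    by rewrite codomE (nth_map j) ?size_enum_ord// nth_ord_enum.
  exists (fun i => c (cast_ord sE i)); move: Wc; congr (W (_ - _)).
  rewrite (reindex (cast_ord sE)) /=; last first.
    by exists (cast_ord (esym sE)) => i _; rewrite ?cast_ordK ?cast_ordKV.
  apply: eq_bigr => i _; congr (_ *: _).
  exact: vE (cast_ord sE i).
move=> [s [Us sU]]; have [b [bs sb indb]] := independent_subsequence s lW.
case: asboolP => [_|nB]; first exact: ltry.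
exfalso; apply: nB; exists (size b), (fun i => b`_i); split=> //.
  by move=> i; apply/Us/bs/mem_nth.
by move=> x /sU; rewrite -sb => /lincombP.
Qed.

End QuotientBasis.

Section Relations.
Context {R : realType} {X : completeNormedModType (Cplx R)}.
Implicit Types (T : linear_relation X) (l : Cplx R).

Lemma linsub_graph T : linsub (graph T).
Proof.
have [T0 TD] := graph_submod T; split; first exact/set_mem.
by move=> a x y Tx Ty; apply/set_mem/TD; exact/mem_set.
Qed.

Lemma ran_rng T : ran T = rng (graph T).
Proof.
apply/seteqP; split=> y [x]; first by move=> _ Txy; exists x.
by move=> Txy; exists x => //; exists y.
Qed.

Lemma null_ker T : null T = ker (graph T).
Proof.
apply/seteqP; split=> x; first by case.
by move=> Tx; split=> //; exists 0.
Qed.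

Lemma graph_shift_rel l T x y :
  graph (shift_rel l T) (x, y) <-> graph T (x, l *: x - y).
Proof.
split=> [[p Tp [<- <-]]|Txy]; first by rewrite subKr -surjective_pairing.
by exists (x, l *: x - y) => //=; rewrite subKr.
Qed.

Lemma graph_shift_relD l e T :
  graph (shift_rel (l + e) T) = shiftG e (graph (shift_rel l T)).
Proof.
apply/seteqP; split=> -[x y] /graph_shift_rel h; apply/graph_shift_rel;
  move: h; congr (graph T (_, _)) => /=;
  by rewrite opprB scalerDl addrA.
Qed.

Lemma closed_shift_rel l T :
  closed_relation T -> closed_relation (shift_rel l T).
Proof.
(* The relation [0 - T] differs from [T] only by a sign in the values; the remaining scalar is
   handled by [closed_shiftG]. *)
move=> cT; have -> : l = 0 + l by rewrite add0r.
rewrite /closed_relation graph_shift_relD; apply: closed_shiftG.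
move/closed_relP : cT => cT; apply/closed_relP => x y h.
apply/graph_shift_rel; rewrite scale0r sub0r; apply: cT => e.
move=> /h[x' [y' [/graph_shift_rel Gx xx yy]]].
exists x', (- y'); split=> //; first by rewrite scale0r sub0r in Gx.
by rewrite -opprD nrmN.
Qed.

Lemma closed_inv_rel T : closed_relation T -> closed_relation (inv_rel T).
Proof.
move=> /closed_relP cT; apply/closed_relP => x y h; apply: cT => e.
by move=> /h[x' [y' [Gx xx yy]]]; exists y', x'.
Qed.

Lemma Phi_minusP T : closed_relation T -> Phi_minus T <->
  closed (rng (graph T)) /\ exists s, lincomb (rng (graph T)) s = setT.
Proof.
move=> cT; rewrite /Phi_minus /beta ran_rng.
have lR := linsub_rng (linsub_graph T).
have lT : linsub [set: X] by [].
split=> [[_ cR /(quotient_dim_lt_pinfty lT lR)[s [_ sT]]]|[cR [s sT]]].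
  by split=> //; exists s; apply/seteqP; split.
by split=> //; apply/(quotient_dim_lt_pinfty lT lR); exists s; rewrite sT.
Qed.

Lemma Phi_plusP T : closed_relation T -> Phi_plus T <->
  closed (rng (graph T)) /\ exists s, (forall v, v \in s -> ker (graph T) v) /\
    ker (graph T) `<=` lincomb [set 0] s.
Proof.
move=> cT; rewrite /Phi_plus /alpha ran_rng null_ker.
have lK := linsub_ker (linsub_graph T).
have l0 : linsub [set (0 : X)].
  by split=> // a x y -> ->; rewrite scaler0 addr0.
split=> [[_ cR /(quotient_dim_lt_pinfty lK l0)[s sP]]|[cR [s sP]]].
  by split=> //; exists s.
by split=> //; apply/(quotient_dim_lt_pinfty lK l0); exists s.
Qed.

Lemma openCP (P : set (Cplx R)) :
  (forall l, P l -> exists2 d : R, 0 < d & forall e, cabs e < d -> P (l + e)) ->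
  open P.
Proof.
move=> h; apply/(@openP R (Cplx R)^o) => l /h[d d0 dP]; exists d => // m ml.
by rewrite -(subrKC l m); exact: dP.
Qed.

Lemma open_rho_e1 T : closed_relation T -> open (rho_e1 T).
Proof.
move=> cT; apply: openCP => l Pl.
have cl m : closed_relation (shift_rel m T) by exact: closed_shift_rel.
have lG := linsub_graph (shift_rel l T).
case: Pl => [/(Phi_plusP (cl _))|/(Phi_minusP (cl _))].
- move=> [cR [s [sK Ks]]].
  have [d d0 dP] := finite_kernel_stable lG (cl l) cR sK Ks.
  exists d => // e /dP h; left; apply/(Phi_plusP (cl _)).
  by rewrite graph_shift_relD.
- move=> [cR [s sR]].
  have [d d0 dP] := cofinite_range_stable lG (cl l) cR sR.
  exists d => // e /dP h; right; apply/(Phi_minusP (cl _)).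
  by rewrite graph_shift_relD.
Qed.

Lemma resolvent_setP T l : resolvent_set T l <->
  ker (graph (shift_rel l T)) `<=` [set 0] /\
  rng (graph (shift_rel l T)) = setT.
Proof.
rewrite /resolvent_set /= null_ker ran_rng; split=> -[K0 RT]; split=> //.
  by rewrite K0.
apply/seteqP; split=> // _ ->; exact: (linsub_ker (linsub_graph _)).1.
Qed.

Lemma open_resolvent_set T : closed_relation T -> open (resolvent_set T).
Proof.
move=> cT; apply: openCP => l /resolvent_setP[K0 RT].
have cl : closed_relation (shift_rel l T) by exact: closed_shift_rel.
have lG := linsub_graph (shift_rel l T).
have cR : closed (rng (graph (shift_rel l T))) by rewrite RT; exact: closedT.
have [d d0 dP] := injective_stable lG cl cR K0.
have [d' d'0 d'P] := surjective_stable lG cl RT.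
exists (Num.min d d'); first by rewrite lt_min d0.
move=> e; rewrite lt_min => /andP[/dP[K0' _] /d'P RT'].
by apply/resolvent_setP; rewrite graph_shift_relD.
Qed.

End Relations.

(** * Components of open subsets of the plane *)

Section Plane.
Context {R : realType}.
Notation C := (Cplx R).
Implicit Types (D S U V : set C) (a z w : C) (r t : R).

Local Notation Re := (@complex.Re R).
Local Notation Im := (@complex.Im R).

Lemma continuous_segment a w : continuous (fun t : R => a + rc t * w : C).
Proof.
move=> t; apply/cvgrPdist_lt => _ /real_pos_Cplx[r r0 ->].
have w0 : 0 < cabs w + 1 by rewrite ltr_wpDl// cabs_ge0.
apply/nbhs_ballP; exists (r / (cabs w + 1)); first by rewrite /= divr_gt0.
move=> s; rewrite /ball /= => ts.
have -> : a + rc t * w - (a + rc s * w) = rc (t - s) * w.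
  by rewrite rcD rcN; ring.
rewrite cabsE ltcR cabsM cabs_real.
apply: (@le_lt_trans _ _ (`|t - s| * (cabs w + 1))).
  by rewrite ler_wpM2l// lerDl.
by rewrite -ltr_pdivlMr.
Qed.

(** Such a set is the union of the segments joining [a] to its points, all of which contain [a]. *)
Lemma star_connected S a :
  (forall z t, S z -> 0 <= t <= 1 -> S (a + rc t * (z - a))) -> connected S.
Proof.
move=> star.
have -> : S = \bigcup_(z in S) [set a + rc t * (z - a) | t in `[0, 1]].
  apply/seteqP; split=> [z Sz|_ [z Sz [t /= + <-]]].
    exists z => //; exists 1; first by rewrite /= in_itv /= ler01 lexx.
    by rewrite rc1 mul1r subrKC.
  by rewrite in_itv /=; exact: star.
have [S0|/set0P[z Sz]] := eqVneq S set0.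
  by rewrite S0 bigcup_set0; exact: connected0.
apply: bigcup_connected.
  exists a => y Sy; exists 0; first by rewrite /= in_itv /= ler01 lexx.
  by rewrite rc0 mul0r addr0.
move=> y Sy; apply: connected_continuous_connected.
  exact: segment_connected.
exact/continuous_subspaceT/continuous_segment.
Qed.

Definition disc a r : set C := [set z | cabs (z - a) < r].

Lemma disc_convex a r z w t : disc a r z -> disc a r w -> 0 <= t <= 1 ->
  disc a r (w + rc t * (z - w)).
Proof.
rewrite /disc /= => za wa /andP[t0 t1].
have -> : w + rc t * (z - w) - a = rc t * (z - a) + rc (1 - t) * (w - a).
  by rewrite rcD rcN rc1; ring.
apply: le_lt_trans (cabsD _ _) _.
rewrite !cabsM !cabs_real ger0_norm// ger0_norm ?subr_ge0//.
have [->|t0'] := eqVneq t 0; first by rewrite mul0r add0r subr0 mul1r.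
have {t0 t0'}t0 : 0 < t by rewrite lt_neqAle eq_sym t0'.
have : t * cabs (z - a) < t * r by rewrite ltr_pM2l.
have : (1 - t) * cabs (w - a) <= (1 - t) * r.
  by rewrite ler_wpM2l ?subr_ge0// ltW.
by lra.
Qed.

Lemma disc_center a r : 0 < r -> disc a r a.
Proof. by rewrite /disc /= subrr cabs0. Qed.

Lemma connected_disc a r : connected (disc a r).
Proof.
apply: (@star_connected _ a) => z t za t01; apply: disc_convex => //.
by apply: disc_center; apply: le_lt_trans za; exact: cabs_ge0.
Qed.

(* For a sign [s], it is star-shaped with respect to [a + s * r / 2]. *)
Definition slit_disc a r (s : R) : set C := [set z |
  disc a r z /\ ~ (Im (z - a) = 0 /\ s * Re (z - a) <= 0)].

(** On the segment from the centre [a + s * r / 2] to [z], the imaginary part relative to [a] is [t]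
    times that of [z - a]. If it vanishes, then either [t = 0] or [z] lies on the unslit half-line,
    and [s] times the real part stays positive. *)
Lemma connected_slit_disc a r s :
  0 < r -> `|s| = 1 -> connected (slit_disc a r s).
Proof.
move=> r0 s1; have ss : s * s = 1.
  by rewrite -expr2 -[s ^+ 2]real_normK ?num_real// s1 expr1n.
apply: (@star_connected _ (a + rc (s * (r / 2)))) => z t [za zs] t01.
split.
  apply: disc_convex => //; rewrite /disc /= addrAC subrr add0r cabs_real.
  by rewrite normrM s1 mul1r gtr0_norm ?divr_gt0//; move: r0; lra.
have -> : a + rc (s * (r / 2)) + rc t * (z - (a + rc (s * (r / 2)))) - a =
   rc (s * (r / 2) * (1 - t)) + rc t * (z - a).
  by rewrite [rc (_ * (1 - t))]rcM rcD rcN rc1; ring.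
move: zs; case: (z - a) => x y /=.
move=> zs [+ +]; rewrite !(mul0r, addr0, add0r, subr0) => ty0.
have [t0|t0] := eqVneq t 0.
  by rewrite t0 mul0r subr0 mulr1 addr0 mulrA ss mul1r; move: r0; lra.
have y0 : y = 0 by move/eqP: ty0; rewrite mulf_eq0 (negbTE t0) => /eqP.
have sx : 0 < s * x by rewrite ltNge; apply/negP => sx; apply: zs.
rewrite mulrDr mulrA [s * (_ * _)]mulrA ss mul1r mulrCA => h.
have {}t0 : 0 < t by rewrite lt_neqAle eq_sym t0; case/andP: t01.
have : 0 < t * (s * x) by rewrite mulr_gt0.
have : 0 <= r / 2 * (1 - t).
  by rewrite mulr_ge0 ?divr_ge0 ?subr_ge0 ?(ltW r0)//; case/andP: t01.
by move: h; lra.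
Qed.

(** The two discs with opposite slits cover the punctured disc and share the point [a + i r / 2]. *)
Lemma connected_punctured_disc a r : 0 < r -> connected (disc a r `\ a).
Proof.
move=> r0.
have -> : disc a r `\ a = slit_disc a r 1 `|` slit_disc a r (- 1).
  apply/seteqP; split=> z.
    move=> [za zna]; apply: contrapT => nz.
    have /not_orP[n1 n2] := nz.
    have [y0 x1] : Im (z - a) = 0 /\ 1 * Re (z - a) <= 0.
      by apply: contrapT => h; apply: n1.
    have [_ x2] : Im (z - a) = 0 /\ - 1 * Re (z - a) <= 0.
      by apply: contrapT => h; apply: n2.
    apply: zna; apply/eqP; rewrite -subr_eq0 eq_complex /= y0 eqxx andbT.
    by apply/eqP; lra.
  by move=> [] [za zs]; split=> // za0; apply: zs; rewrite za0 subrr /= mulr0.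
apply: connectedU; last 2 first.
- by apply: connected_slit_disc; rewrite ?normr1.
- by apply: connected_slit_disc; rewrite ?normrN1.
have r20 : r / 2 != 0 by rewrite gt_eqF// divr_gt0.
have ai : disc a r (a + rc (r / 2) * ('i%C : C)).
  rewrite /disc /= addrAC subrr add0r cabsM cabs_real cabs_i.
  by rewrite mulr1 gtr0_norm ?divr_gt0//; move: r0; lra.
exists (a + rc (r / 2) * ('i%C : C)); split; split=> // -[+ _];
  rewrite addrAC subrr add0r /= mulr1 mul0r addr0 => /eqP;
  by rewrite (negbTE r20).
Qed.

(** In a separation of [D] without [a], the punctured disc around [a] lies on one side; adding [a]
    to that side would separate [D]. *)
Lemma connected_punctured D a : connected D ->
  (D a -> exists2 r : R, 0 < r & disc a r `<=` D) -> connected (D `\ a).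
Proof.
move=> cD Da; have [/Da[r r0 rD]|nDa] := pselect (D a); last first.
  by rewrite not_setD1.
have cP := @connected_punctured_disc a r r0.
apply/connectedP => E [E0 DE sE].
wlog PE : E E0 DE sE / disc a r `\ a `<=` E false.
  move=> wl; have [] := connected_subset sE _ cP.
  - by rewrite -DE; exact: setSD.
  - exact: wl.
  move=> PE; apply: (wl (E \o negb)) => //=; first by rewrite setUC.
  by rewrite separatedC.
have ED b z : E b z -> D z /\ z <> a.
  move=> Ez; have : (D `\ a) z by rewrite DE; case: b Ez; [right|left].
  by case.
have dE := separated_disjoint sE.
move/connectedP : cD => /(_ (fun b => if b then E true else a |` E false)).
apply; split.
- by case; [exact: E0|exists a; left].
- rewrite -setUA -DE setUC; apply/seteqP; split=> z.
    by move=> Dz; have [->|za] := pselect (z = a); [right|left].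
  by move=> [[]//|->]; apply: rD; exact: disc_center.
have [sE1 sE2] := sE; split.
  rewrite closureU; apply/seteqP; split=> // z [[za|Ez] Etz].
    have : closed [set a].
      apply: accessible_closed_set1; apply: hausdorff_accessible.
      exact: norm_hausdorff.
    by move=> /closure_id ca; rewrite -ca in za; have [_] := ED _ _ Etz; apply.
  by rewrite -sE1.
apply/seteqP; split=> // z [[->|Ez] cz]; last by rewrite -sE2.
have /cz[w [Ew wa]] : nbhs a (disc a r).
  by apply/(@nbhs_nrmP R C^o); exists r.
suff : set0 w by [].
rewrite -dE; split=> //; apply: PE; split=> //.
by have [_] := ED _ _ Ew.
Qed.

(** A pointwise form of the union of components defining [rho_e5], freed from relations so that the
    topology can be treated for arbitrary plane sets. *)
Definition meets_component U V : set C :=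
  [set z | U z /\ connected_component U z `&` V !=set0].

(** Deleting [a] from the component [D] of [z] keeps it connected, so its image under [f] is a
    connected subset of [U'] containing [f z]. The image meets [V'] because [V] still meets [D]
    without [a]. *)
Lemma meets_component_image U V U' V' (f : C -> C) a :
  open U -> open V ->
  (forall z, z <> a -> {for z, continuous f}) ->
  (forall z, z <> a -> U z -> U' (f z)) ->
  (forall z, z <> a -> V z -> V' (f z)) ->
  forall z, z <> a -> meets_component U V z -> meets_component U' V' (f z).
Proof.
move=> oU oV fc fU fV z za [Uz [v [Dv Vv]]].
pose D := connected_component U z.
have cD : connected D by exact: component_connected.
have Da : D a -> exists2 r : R, 0 < r & disc a r `<=` D.
  move=> Da; have /(@openP R C^o)/(_ a) := oU.
  case; first exact: connected_component_sub Da.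
  move=> r r0 rU; exists r => //.
  have /same_connected_component DE := Da.
  rewrite /D DE; apply: connected_component_max => //.
    exact: disc_center.
  exact: connected_disc.
have cDa := connected_punctured cD Da.
have [w [[Dw wa] Vw]] : (D `\ a) `&` V !=set0.
  (* If the known common point is [a] itself, a small real translate of it still lies in both [D]
     and [V], as each contains a disc around [a]. *)
  have [va|va] := pselect (v = a); last by exists v.
  have [r r0 rD] : exists2 r : R, 0 < r & disc a r `<=` D.
    by apply: Da; rewrite -va.
  have /(@openP R C^o)/(_ v Vv)[r' r'0 r'V] := oV.
  pose d := Num.min r r' / 2.
  have m0 : 0 < Num.min r r' by rewrite lt_min r0.
  have dm : d < Num.min r r' by rewrite /d; move: m0; lra.
  have d0 : 0 < d by rewrite divr_gt0.
  have da : cabs (a + rc d - a) = d.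
    by rewrite addrAC subrr add0r cabs_real gtr0_norm.
  exists (a + rc d); split; first split.
  - by apply: rD; rewrite /disc /= da; move: dm; rewrite lt_min => /andP[].
  - move=> /= h; move: da; rewrite h subrr cabs0 => h0.
    by rewrite -h0 ltxx in d0.
  - by apply: r'V; rewrite va [nrm _]da; move: dm; rewrite lt_min => /andP[].
have Dz : (D `\ a) z by split=> //; exact: connected_component_refl.
have sub : f @` (D `\ a) `<=` connected_component U' (f z).
  apply: connected_component_max.
  - by exists z.
  - move=> _ [y [Dy ya] <-]; apply: fU => //.
    exact: connected_component_sub Dy.
  - apply: connected_continuous_connected => //.
    apply: continuous_in_subspaceT => y; rewrite inE => -[_ ya]; exact: fc.
split; first by apply: fU.
exists (f w); split; first by apply: sub; exists w.
exact: fV.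
Qed.

End Plane.

(** * The resolvent transformation *)

Section Resolvent.
Context {R : realType} {X : completeNormedModType (Cplx R)}.
Implicit Types (T : linear_relation X) (l mu : Cplx R).

(** With [z := eta *: x - y], both sides say that [z] is a value of [(mu - T)^-1] at [x], that is,
    that [x] is a value of [mu - T] at [z]. *)
Lemma graph_resolvent T mu eta x y :
  graph (shift_rel eta (inv_rel (shift_rel mu T))) (x, y) <->
  graph T (eta *: x - y, mu *: (eta *: x - y) - x).
Proof. by rewrite graph_shift_rel; exact: graph_shift_rel. Qed.

(** For [y = 0] the pair in [graph_resolvent], multiplied by [mu - l], becomes [(x, l *: x)]. *)
Lemma ker_resolvent T mu l : l <> mu ->
  ker (graph (shift_rel (mu - l)^-1 (inv_rel (shift_rel mu T)))) =
  ker (graph (shift_rel l T)).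
Proof.
move=> /eqP lmu; have c0 : mu - l != 0 by rewrite subr_eq0 eq_sym.
have lT := linsub_graph T.
apply/seteqP; split=> x.
  move=> /graph_resolvent /(linsubZ (mu - l) lT) Tx.
  apply/graph_shift_rel; move: Tx; congr (graph T _); congr (_, _).
    by rewrite /= subr0 scalerA divff// scale1r.
  rewrite /= !subr0 scalerBr !scalerA -scalerBl; congr (_ *: _).
  by field.
move=> /graph_shift_rel /(linsubZ (mu - l)^-1 lT) Tx.
apply/graph_resolvent; move: Tx; congr (graph T _); congr (_, _).
  by rewrite /= subr0.
rewrite /= !subr0 !scalerA -[X in _ = _ - X]scale1r -scalerBl; congr (_ *: _).
by field.
Qed.

(** The substitution [x = (mu - l) *: (z + y)] shows that [y] is a value of the left relation at [x]
    exactly when [(mu - l) *: y] is a value of [l - T] at [z]; ranges are invariant under nonzero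
    scalars. *)
Lemma rng_resolvent T mu l : l <> mu ->
  rng (graph (shift_rel (mu - l)^-1 (inv_rel (shift_rel mu T)))) =
  rng (graph (shift_rel l T)).
Proof.
move=> /eqP lmu; have c0 : mu - l != 0 by rewrite subr_eq0 eq_sym.
have lR := linsub_rng (linsub_graph (shift_rel l T)).
have muE z y : mu *: z - (mu - l) *: (z + y) = l *: z - (mu - l) *: y.
  by rewrite scalerDr opprD addrA -scalerBl subKr.
apply/seteqP; split=> y.
  move=> [x /graph_resolvent].
  set z := _ *: x - y => Tz.
  have xE : x = (mu - l) *: (z + y).
    by rewrite subrK scalerA divff// scale1r.
  suff : rng (graph (shift_rel l T)) ((mu - l) *: y).
    by move=> /(linsubZ (mu - l)^-1 lR); rewrite scalerA mulVf// scale1r.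
  by exists z; apply/graph_shift_rel; rewrite -muE -xE.
move=> /(linsubZ (mu - l) lR)[z /graph_shift_rel Tz].
exists ((mu - l) *: (z + y)); apply/graph_resolvent.
by rewrite scalerA mulVf// scale1r addrK muE.
Qed.

Lemma Phi_plus_resolvent T mu l : closed_relation T -> l <> mu ->
  Phi_plus (shift_rel (mu - l)^-1 (inv_rel (shift_rel mu T))) <->
  Phi_plus (shift_rel l T).
Proof.
move=> cT lmu; rewrite !Phi_plusP ?ker_resolvent ?rng_resolvent//.
  exact: closed_shift_rel.
exact/closed_shift_rel/closed_inv_rel/closed_shift_rel.
Qed.

Lemma Phi_minus_resolvent T mu l : closed_relation T -> l <> mu ->
  Phi_minus (shift_rel (mu - l)^-1 (inv_rel (shift_rel mu T))) <->
  Phi_minus (shift_rel l T).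
Proof.
move=> cT lmu; rewrite !Phi_minusP ?rng_resolvent//.
  exact: closed_shift_rel.
exact/closed_shift_rel/closed_inv_rel/closed_shift_rel.
Qed.

Lemma kappa_resolvent T mu l : l <> mu ->
  kappa (shift_rel (mu - l)^-1 (inv_rel (shift_rel mu T))) =
  kappa (shift_rel l T).
Proof.
move=> lmu.
by rewrite /kappa /alpha /beta !null_ker !ran_rng ker_resolvent// rng_resolvent.
Qed.

Lemma resolvent_set_resolvent T mu l : l <> mu ->
  resolvent_set (inv_rel (shift_rel mu T)) (mu - l)^-1 <-> resolvent_set T l.
Proof.
by move=> lmu; rewrite !resolvent_setP ker_resolvent// rng_resolvent.
Qed.

Lemma rho_e1_resolvent T mu l : closed_relation T -> l <> mu ->
  rho_e1 (inv_rel (shift_rel mu T)) (mu - l)^-1 <-> rho_e1 T l.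
Proof.
move=> cT lmu.
by rewrite /rho_e1 /= Phi_plus_resolvent// Phi_minus_resolvent.
Qed.

Lemma rho_e5E T : rho_e5 T = meets_component (rho_e1 T) (resolvent_set T).
Proof.
apply/seteqP; split=> l.
  move=> [D [[z Uz ->] DV] zl]; split.
    exact: connected_component_sub zl.
  by rewrite -(same_connected_component zl).
move=> [Ul DV]; exists (connected_component (rho_e1 T) l).
  by split=> //; exists l.
exact: connected_component_refl.
Qed.

(** Both directions are instances of [meets_component_image]: one for the map sending [z] to
    [(mu - z)^-1] away from [mu], the other for its inverse, sending [z] to [mu - z^-1] away from
    [0]. *)
Lemma rho_e5_resolvent T mu l : closed_relation T -> l <> mu ->
  rho_e5 (inv_rel (shift_rel mu T)) (mu - l)^-1 <-> rho_e5 T l.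
Proof.
move=> cT lmu; set S := inv_rel (shift_rel mu T).
have cS : closed_relation S by exact/closed_inv_rel/closed_shift_rel.
have mu0 z : z <> mu -> mu - z != 0.
  by move=> /eqP zmu; rewrite subr_eq0 eq_sym.
have back z : z <> 0 -> mu - z^-1 <> mu /\ (mu - (mu - z^-1))^-1 = z.
  move=> /eqP z0; split; last by rewrite subKr invrK.
  by apply/eqP; rewrite -subr_eq0 addrAC subrr add0r oppr_eq0 invr_eq0.
rewrite !rho_e5E; split.
  have lE : mu - ((mu - l)^-1)^-1 = l by rewrite invrK subKr.
  rewrite -{2}lE.
  apply: (@meets_component_image R _ _ _ _ (fun z => mu - z^-1) 0).
  - exact: open_rho_e1.
  - exact: open_resolvent_set.
  - move=> z /eqP z0; apply: continuousB; first exact: cst_continuous.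
    exact: inv_continuous.
  - move=> z /back[zmu zE]; rewrite -{1}zE; exact: (rho_e1_resolvent cT zmu).1.
  - move=> z /back[zmu zE]; rewrite -{1}zE.
    exact: (resolvent_set_resolvent T zmu).1.
  - by apply/eqP; rewrite invr_eq0 mu0.
apply: (@meets_component_image R _ _ _ _ (fun z => (mu - z)^-1) mu) => //.
- exact: open_rho_e1.
- exact: open_resolvent_set.
- move=> z zmu; apply: continuousV; first exact: mu0.
  by apply: continuousB; [exact: cst_continuous|exact: cvg_id].
- by move=> z zmu /(rho_e1_resolvent cT zmu).
- by move=> z zmu /(resolvent_set_resolvent T zmu).
Qed.

End Resolvent.

Theorem theorem5p2 (R : realType) (X : completeNormedModType (Cplx R))
    (T : linear_relation X) (hT : closed_relation T)
    (mu : Cplx R) (hmu : resolvent_set T mu)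
    (lambda : Cplx R) (hlambda : lambda <> mu) :
  let Tmu := inv_rel (shift_rel mu T) in
  [/\ sigma_e1 T lambda <-> sigma_e1 Tmu (mu - lambda)^-1,
      sigma_e2 T lambda <-> sigma_e2 Tmu (mu - lambda)^-1,
      sigma_e3 T lambda <-> sigma_e3 Tmu (mu - lambda)^-1,
      sigma_e4 T lambda <-> sigma_e4 Tmu (mu - lambda)^-1 &
      sigma_e5 T lambda <-> sigma_e5 Tmu (mu - lambda)^-1].
Proof.
move=> Tmu.
have Pp := Phi_plus_resolvent hT hlambda.
have Pm := Phi_minus_resolvent hT hlambda.
have k := kappa_resolvent T hlambda.
have e5 := rho_e5_resolvent hT hlambda.
split; apply: not_iff_compat; first by rewrite /rho_e1 /= Pp Pm.
- by rewrite /rho_e2 /= Pp.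
- by rewrite /rho_e3 /Phi /= Pp Pm.
- by rewrite /rho_e4 /Phi /= Pp Pm k.
- by rewrite e5.
Qed.
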